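(* Fix $\alpha\in(0,1/2]$, $r>1$ with $r^2$ an integer, $\kappa:=1/r$, $\beta\ge\frac14(1-\kappa)^{-2}$, and a constant $\gamma_P>2$. Let $f(t):=(t\ln t)^{1/2}$. For an input $X$ of $n$ totally ordered elements and $1\le k\le n$, let $c_{nk}$ be the (random) number of element comparisons made by the nonrecursive version of $\textsc{Select}(X,k)$ described in the context. Then for $n\ge6$, $$\mathrm{P}\left[c_{nk}\le n+\min\{k,n-k\}+\hat\gamma_Pf(n)\right]\ge1-\bar l\,\mathrm{P}_{\rm fail},\qquad \hat\gamma_P:=2\gamma_P+\frac{2r^2-r}{r-1}(3+8\gamma_P)\beta^{1/2},$$ where $\mathrm{P}_{\rm fail}:=2n^{-2\beta}+2n^{-2(1-\kappa)^2\beta}$ and $$\bar l\,\mathrm{P}_{\rm fail}\le4\left\lceil(1-\alpha)\ln n/\ln r^2\right\rceil n^{-2(1-\kappa)^2\beta}.$$ In particular $\bar l\,\mathrm{P}_{\rm fail}=o(n^{-1})$ if $\beta>\frac12(1-\kappa)^{-2}$. Moreover, $$\mathrm{E}\,c_{nk}\le n+\min\{k,n-k\}+\bar\gamma_Pf(n),\qquad \bar\gamma_P:=\hat\gamma_P+4\left(\frac{2r^2-1}{r^2-1}2\gamma_P+\frac12\right)n^{1/2-2(1-\kappa)^2\beta}\ln^{-1/2}n,$$ and in particular $\bar\gamma_P\le\hat\gamma_P+16\gamma_P+2$.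
   Context: Selection problem: given a finite set (elements may be equal) $X=\{x_j\}_{j=1}^n$ with a total order and $1\le k\le n$, find a $k$th smallest element (an $x\in X$ with at most $k-1$ elements $x_j<x$ and at least $k$ elements $x_j\le x$). Probabilities/expectations are over the algorithm's random sampling. Nonrecursive rounded $\textsc{Select}(X,k)$ with parameters $\alpha,r,\kappa,\beta,\gamma_P$ as in the claim. It uses a deterministic subroutine that finds the $i$th smallest of any $m$ elements using at most $\gamma_Pm$ comparisons. Step 1: If $n=1$ return $x_1$. Set $s_1:=\min\{\lceil n^\alpha\rceil,n-1\}$, $\bar l:=\min\{l:r^{2l}s_1\ge n\}$, $\theta:=k/n$, $l:=1$. Step 2: Draw a uniformly random sample $S_1$ of size $s_1$ from $X$. Define $g_l:=(\beta s_l\ln n)^{1/2}$ for $l\le\bar l$, $g_{\bar l+1}:=0$, $i_u^l:=\max\{\lceil\theta s_l-g_l\rceil,1\}$, $i_v^l:=\min\{\lceil\theta s_l+g_l\rceil,s_l\}$. Compute $u_1$, $v_1$ as the $i_u^1$th and $i_v^1$th smallest elements of $S_1$ with the subroutine. Step 3: Draw $S_{l+1}\supset S_l$ of size $s_{l+1}:=\min\{r^{2l}s_1,n\}$ by adding $s_{l+1}-s_l$ uniformly random elements of $X\setminus S_l$. Step 4: With $u:=u_l$, $v:=v_l$, compare each $x\in S_{l+1}\setminus S_l$ with $u,v$ (positions of elements of $S_l$ relative to $u,v$ are already known) to partition $S_{l+1}$ into $L=\{x<u\}$, $U=\{x=u\}$, $M=\{u<x<v\}$, $V=\{x=v\}$,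 $R=\{v<x\}$; if $\theta<1/2$, compare with $v$ first and with $u$ only if $x<v$; if $\theta\ge1/2$ the order is reversed. Step 5: Let $i_u^+:=i_u^{l+1}$, $i_v^+:=i_v^{l+1}$. If $|L|<i_u^+\le|L\cup U|$ set $u_{l+1}:=u$; else if $|L\cup U\cup M|<i_u^+\le s_{l+1}-|R|$ set $u_{l+1}:=v$; else $u_{l+1}$ is the $\hat\imath_u^+$th smallest element of $\hat S_u$ (found by the subroutine), where: if $i_u^+\le|L|$, $\hat S_u:=L$, $\hat\imath_u^+:=i_u^+$; if $s_{l+1}-|R|<i_u^+$, $\hat S_u:=R$, $\hat\imath_u^+:=i_u^+-s_{l+1}+|R|$; else $\hat S_u:=M$, $\hat\imath_u^+:=i_u^+-|L\cup U|$. Find $v_{l+1}$ in the same way using $i_v^+$. Step 6: If $s_{l+1}=n$ return $u_{l+1}$; else increase $l$ by 1 and go to Step 3.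
   Formalization: The final bound γ̄_P ≤ γ̂_P+16γ_P+2 is stated only for r²≥3 or n≥10; as printed it fails for r²=2 and n=6,…,9 (e.g. n=6, β=¼(1−κ)^{-2}, γ_P=3). *)

(* Defs.v *)
From HB Require Import structures.
From mathcomp Require Import all_boot all_order all_algebra.
From mathcomp Require Import all_classical all_reals all_analysis.

Set Implicit Arguments.
Unset Strict Implicit.
Unset Printing Implicit Defensive.

Import Order.TTheory GRing.Theory Num.Theory.
Import numFieldNormedType.Exports.

Local Open Scope ring_scope.

(* Finitely supported randomized computations.  [Draw A m f] draws a uniformly
   random m-element subset B of A and continues with f B.                     *)
Inductive rand (I : finType) (A : Type) : Type :=
| Ret of A
| Draw of {set I} & nat & ({set I} -> rand I A).

Arguments Ret {I A}.
Arguments Draw {I A}.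

Definition draws (I : finType) (A : {set I}) (m : nat) : {set {set I}} :=
  [set B : {set I} | (B \subset A) && (#|B| == m)].

Fixpoint expect (R : realType) (I : finType) (A : Type) (p : rand I A)
    (f : A -> R) : R :=
  match p with
  | Ret a => f a
  | Draw D m p' =>
      (\sum_(B in draws D m) expect (p' B) f) / #|draws D m|%:R
  end.
Arguments expect {R I A} p f.

Definition prob (R : realType) (I : finType) (A : Type) (p : rand I A)
    (E : pred A) : R :=
  expect p (fun a => (E a)%:R).
Arguments prob {R I A} p E.

(* Deterministic comparison algorithms returning an index are ternary decision
   trees: [Node i j tlt teq tgt] compares x_i with x_j, and continues with tlt,
   teq or tgt according to x_i < x_j, x_i = x_j or x_i > x_j.                  *)
Inductive dtree (I : Type) : Type :=
| Leaf of I
| Node of I & I & dtree I & dtree I & dtree I.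

(* The second component is the number of comparisons made. *)
Fixpoint dtree_run (d : Order.disp_t) (T : orderType d) (I : Type) (x : I -> T)
    (t : dtree I) : I * nat :=
  match t with
  | Leaf i => (i, 0%N)
  | Node i j tlt teq tgt =>
      let: (a, c) :=
        if (x i < x j)%O then dtree_run x tlt
        else if x i == x j then dtree_run x teq
        else dtree_run x tgt in
      (a, c.+1)
  end.

(* The elements of the input are the x i; they are designated by their indices,
   since equal elements may occur.                                            *)
Definition ith_smallest (d : Order.disp_t) (T : orderType d) (I : finType)
    (x : I -> T) (S : {set I}) (i : nat) (y : I) : bool :=
  [&& y \in S,
      (#|[set z in S | (x z < x y)%O]| <= i - 1)%N
    & (i <= #|[set z in S | (x z <= x y)%O]|)%N].

(* The trees depend only on the index set S and the rank i; the values of the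
   elements are accessible through comparisons only.                          *)
Definition selection_subroutine (R : realType) (d : Order.disp_t)
    (T : orderType d) (n : nat) (gammaP : R)
    (sel : {set 'I_n} -> nat -> dtree 'I_n) : Prop :=
  forall (x : 'I_n -> T) (S : {set 'I_n}) (i : nat),
    (1 <= i <= #|S|)%N ->
    ith_smallest x S i (dtree_run x (sel S i)).1 /\
    ((dtree_run x (sel S i)).2)%:R <= gammaP * #|S|%:R.

(* In the following definitions q is the integer r^2. *)

Definition size1 (R : realType) (alpha : R) (n : nat) : nat :=
  minn `|Num.ceil (n%:R `^ alpha)|%N n.-1.

(* The least l with n <= q ^ l * s_1; it is at most n when 1 < n and 1 < q,
   so the search over 0, ..., n succeeds.                                     *)
Definition lbar (R : realType) (alpha : R) (q n : nat) : nat :=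
  find (fun l => (n <= q ^ l * size1 alpha n)%N) (iota 0 n.+1).

Definition size_at (R : realType) (alpha : R) (q n l : nat) : nat :=
  minn (q ^ l.-1 * size1 alpha n) n.

Definition gap (R : realType) (alpha beta : R) (q n l : nat) : R :=
  if (l <= lbar alpha q n)%N
  then Num.sqrt (beta * (size_at alpha q n l)%:R * ln n%:R)
  else 0.

Definition theta (R : realType) (n k : nat) : R := k%:R / n%:R.

Definition rank_u (R : realType) (alpha beta : R) (q n k l : nat) : nat :=
  `|Num.max
      (Num.ceil (theta R n k * (size_at alpha q n l)%:R - gap alpha beta q n l))
      1|%N.

Definition rank_v (R : realType) (alpha beta : R) (q n k l : nat) : nat :=
  `|Num.min
      (Num.ceil (theta R n k * (size_at alpha q n l)%:R + gap alpha beta q n l))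
      (size_at alpha q n l)%:Z|%N.

(* Number of comparisons used to classify the elements of D with respect to u
   and v.                                                                     *)
Definition partition_cost (R : realType) (d : Order.disp_t) (T : orderType d)
    (n k : nat) (x : 'I_n -> T) (D : {set 'I_n}) (u v : 'I_n) : nat :=
  (\sum_(y in D)
     if (theta R n k < 2^-1)%R then 1 + (x y < x v)%O else 1 + (x u < x y)%O)%N.

(* The i-th smallest element of S, given the positions of the elements of S
   relative to u and v, together with the number of further comparisons.      *)
Definition next_pivot (d : Order.disp_t) (T : orderType d) (n : nat)
    (x : 'I_n -> T) (sel : {set 'I_n} -> nat -> dtree 'I_n)
    (S : {set 'I_n}) (u v : 'I_n) (i : nat) : 'I_n * nat :=
  let L := [set y in S | (x y < x u)%O] in
  let U := [set y in S | x y == x u] in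
  let M := [set y in S | (x u < x y)%O && (x y < x v)%O] in
  let Rt := [set y in S | (x v < x y)%O] in
  if (#|L| < i <= #|L :|: U|)%N then (u, 0%N)
  else if (#|L :|: U :|: M| < i <= #|S| - #|Rt|)%N then (v, 0%N)
  else if (i <= #|L|)%N then dtree_run x (sel L i)
  else if (#|S| - #|Rt| < i)%N then dtree_run x (sel Rt (i - (#|S| - #|Rt|))%N)
  else dtree_run x (sel M (i - #|L :|: U|)%N).

(* Iterations l, l + 1, ...; c is the number of comparisons made so far.  For
   the positions of the elements of S relative to u and v, which are known, no
   comparison is counted.  When s_{l+1} = n, which occurs first for l = lbar,
   the computation stops, so that [fuel = lbar] starting from l = 1 never runs
   out.                                                                       *)
Fixpoint select_loop (R : realType) (alpha beta : R) (q : nat)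
    (d : Order.disp_t) (T : orderType d) (n : nat) (x : 'I_n -> T) (k : nat)
    (sel : {set 'I_n} -> nat -> dtree 'I_n)
    (fuel l : nat) (S : {set 'I_n}) (u v : 'I_n) (c : nat) :
    rand 'I_n ('I_n * nat) :=
  if fuel is fuel'.+1 then
    Draw (~: S) (size_at alpha q n l.+1 - size_at alpha q n l)%N (fun D =>
      let S' := S :|: D in
      let: (u', cu) := next_pivot x sel S' u v (rank_u alpha beta q n k l.+1) in
      let: (v', cv) := next_pivot x sel S' u v (rank_v alpha beta q n k l.+1) in
      let c' := (c + partition_cost R k x D u v + cu + cv)%N in
      if size_at alpha q n l.+1 == n then Ret (u', c')
      else select_loop alpha beta q x k sel fuel' l.+1 S' u' v' c')
  else Ret (u, c).

(* The outcome is the index of the selected element paired with the number of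
   comparisons made.                                                          *)
Definition select (R : realType) (alpha beta : R) (q : nat)
    (d : Order.disp_t) (T : orderType d) (n : nat) (x : 'I_n -> T) (k : nat)
    (sel : {set 'I_n} -> nat -> dtree 'I_n) : rand 'I_n ('I_n * nat) :=
  if [pick i : 'I_n | n == 1%N] is Some i then Ret (i, 0%N)
  else
    Draw [set: 'I_n] (size1 alpha n) (fun S1 =>
      let: (u, cu) := dtree_run x (sel S1 (rank_u alpha beta q n k 1)) in
      let: (v, cv) := dtree_run x (sel S1 (rank_v alpha beta q n k 1)) in
      select_loop alpha beta q x k sel (lbar alpha q n) 1 S1 u v (cu + cv)%N).

Definition fsel (R : realType) (t : R) : R := Num.sqrt (t * ln t).

Definition gamma_hat (R : realType) (gammaP r beta : R) : R :=
  2 * gammaP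
  + (2 * r ^+ 2 - r) / (r - 1) * (3 + 8 * gammaP) * Num.sqrt beta.

Definition gamma_bar (R : realType) (gammaP r kappa beta : R) (n : nat) : R :=
  gamma_hat gammaP r beta
  + 4 * ((2 * r ^+ 2 - 1) / (r ^+ 2 - 1) * (2 * gammaP) + 2^-1)
      * n%:R `^ (2^-1 - 2 * (1 - kappa) ^+ 2 * beta)
      * (ln n%:R) `^ (- 2^-1).

Definition P_fail (R : realType) (kappa beta : R) (n : nat) : R :=
  2 * n%:R `^ (- (2 * beta)) + 2 * n%:R `^ (- (2 * (1 - kappa) ^+ 2 * beta)).

(* Main.v *)
(* Idea. Conditionally on the next sample N = S_{l+1}, the current sample
   S = S_l is a uniformly random s_l-subset of N, so ranks in N of the pivots
   u and v, which are order statistics of S, are controlled by hypergeometric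
   tails: Hoeffding's bound exp(-2 t^2 / s) with t = g_l bounds the pivots from
   outside, and with t = (1 - kappa) g_l it shows that they enclose the targets
   of the next step, because g_{l+1} s_l / s_{l+1} <= kappa g_l. Outside the
   failure events step l costs at most
     |D| + min(theta, 1 - theta) |D| + (3 + 8 gammaP) g_l s_{l+1} / s_l
   comparisons, where D = S_{l+1} \ S_l; the last terms form a geometric sum.
   For the expectation, a failure costs at most |D| extra comparisons in the
   partition, where only one of the four failure events matters, and
   2 gammaP s_{l+1} in the selections.

   Equal elements are handled by lower sets: a lower set of N with exactly j
   elements exists for each j <= |N| and plays the role of the first j elements
   of N, so all the events are about the size of its intersection with S. *)
Require Import Defs.
From HB Require Import structures.
From mathcomp Require Import all_boot all_order all_algebra.
From mathcomp Require Import all_classical all_reals all_analysis.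
From mathcomp Require Import ring lra zify.

Set Implicit Arguments.
Unset Strict Implicit.
Unset Printing Implicit Defensive.

Import Order.TTheory GRing.Theory Num.Theory.
Import numFieldNormedType.Exports.

Local Open Scope classical_set_scope.
Local Open Scope ring_scope.

(** * Uniformly random subsets *)

Section Average.
Variables (R : realType) (I : finType).
Implicit Types (A B D E J S : {set I}) (m s : nat) (f : {set I} -> R).

(** Verbatim the [Draw] case of [expect], so that expectations fold into nested averages. *)
Definition avg E m f : R := (\sum_(B in draws E m) f B) / #|draws E m|%:R.

Lemma drawsP E m B : reflect (B \subset E /\ #|B| = m) (B \in draws E m).
Proof. by rewrite inE; apply: (iffP andP) => -[-> /eqP]. Qed.

Lemma card_draws_bin E m : #|draws E m| = 'C(#|E|, m).
Proof. exact: cards_draws. Qed.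

Lemma card_draws_gt0 E m : (m <= #|E|)%N -> (0 < #|draws E m|)%N.
Proof. by rewrite card_draws_bin bin_gt0. Qed.

Lemma eq_avg E m f g :
  {in draws E m, f =1 g} -> avg E m f = avg E m g.
Proof. by move=> fg; rewrite /avg (eq_bigr _ fg). Qed.

Lemma ler_avg E m f g :
  {in draws E m, forall B, f B <= g B} -> avg E m f <= avg E m g.
Proof. by move=> fg; rewrite ler_wpM2r ?invr_ge0 ?ler0n // ler_sum. Qed.

Lemma avgD E m f g : avg E m (fun B => f B + g B) = avg E m f + avg E m g.
Proof. by rewrite /avg big_split mulrDl. Qed.

Lemma avgZ E m f c : avg E m (fun B => c * f B) = c * avg E m f.
Proof. by rewrite /avg -mulr_sumr mulrA. Qed.

Lemma avg_cst E m c : (m <= #|E|)%N -> avg E m (fun=> c) = c.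
Proof.
move=> mE; rewrite /avg sumr_const -[c *+ _]mulr_natr mulfK //.
by rewrite pnatr_eq0 -lt0n card_draws_gt0.
Qed.

Lemma avg_sum (J : Type) (r : seq J) (P : pred J) E m (F : J -> {set I} -> R) :
  avg E m (fun B => \sum_(j <- r | P j) F j B)
  = \sum_(j <- r | P j) avg E m (F j).
Proof. by rewrite /avg exchange_big mulr_suml. Qed.

Lemma sum_indicator (T : finType) (P : {set T}) (b : pred T) :
  \sum_(y in P) (b y)%:R = #|[set y in P | b y]|%:R :> R.
Proof.
rewrite -sum1_card natr_sum (eq_bigl (fun y => (y \in P) && b y)); last first.
  by move=> y; rewrite inE.
by rewrite [RHS]big_mkcondr; apply: eq_bigr => y _; case: (b y).
Qed.

(** Both sides run over the flags of an s-set S inside an m-set S'; for fixed S, the sets D and S'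
    determine each other through S' = S :|: D and D = S' :\: S. *)
Lemma sum_draws_exchange E s m (phi : {set I} -> {set I} -> R) :
  (s <= m)%N ->
  \sum_(S in draws E s) \sum_(D in draws (E :\: S) (m - s)) phi S (S :|: D)
  = \sum_(S' in draws E m) \sum_(S in draws S' s) phi S S'.
Proof.
move=> sm.
transitivity (\sum_(S in draws E s)
                \sum_(S' in draws E m | S \subset S') phi S S').
  apply: eq_bigr => S /drawsP[SE cS].
  rewrite (reindex_onto (fun S' => S' :\: S) (fun D => S :|: D)) /=; last first.
    move=> D /drawsP[]; rewrite finset.subsetD => /andP[_ DS] _.
    rewrite finset.setDUl finset.setDv finset.set0U; apply/finset.setDidPl.
    exact: DS.
  apply: congr_big => // S'.
    apply/andP/andP=> [[/drawsP[DE cD] /eqP eS]|[/drawsP[S'E cS'] SS']].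
      have SS' : S \subset S' by rewrite -eS finset.subsetUl.
      split=> //; apply/drawsP; split.
        rewrite -eS finset.subUset SE; apply: (fintype.subset_trans DE); exact: finset.subsetDl.
      by move: cD; rewrite finset.cardsDS // cS; have := subset_leq_card SS'; lia.
    split; last first.
      by have /finset.setIidPr e := SS'; rewrite -{1}e finset.setID.
    by apply/drawsP; rewrite finset.setSD // finset.cardsDS // cS' cS.
  by move=> /andP[_ /eqP ->].
rewrite (exchange_big_dep (mem (draws E m))) /=; last by move=> ? ? _ /andP[].
apply: eq_bigr => S' S'm; apply: eq_bigl => S.
move/drawsP: (S'm) => [S'E _]; rewrite S'm /=.
apply/andP/drawsP=> [[/drawsP[_ ->] ->] //|[SS' cS]]; split => //.
by apply/drawsP; split=> //; apply: (fintype.subset_trans SS' S'E).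
Qed.

(** Source of the conditioning on the next sample: the pair may be generated from the larger set
    downwards, so that the smaller set becomes a uniform subsample of a fixed one. *)
Lemma avg_exchange E s m (phi : {set I} -> {set I} -> R) :
  (s <= m <= #|E|)%N ->
  avg E s (fun S => avg (E :\: S) (m - s) (fun D => phi S (S :|: D)))
  = avg E m (fun S' => avg S' s (fun S => phi S S')).
Proof.
move=> /andP[sm mE]; have sE := leq_trans sm mE.
have lhs psi : avg E s (fun S => avg (E :\: S) (m - s) (fun D => psi S (S :|: D)))
    = (\sum_(S in draws E s) \sum_(D in draws (E :\: S) (m - s)) psi S (S :|: D))
      / ('C(#|E| - s, m - s) * 'C(#|E|, s))%:R.
  rewrite /avg natrM invfM mulrA; congr (_ / _); last by rewrite card_draws_bin.
  rewrite mulr_suml; apply: eq_bigr => S /drawsP[SE cS].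
  by rewrite card_draws_bin finset.cardsDS // cS.
have rhs psi : avg E m (fun S' => avg S' s (fun S => psi S S'))
    = (\sum_(S' in draws E m) \sum_(S in draws S' s) psi S S')
      / ('C(m, s) * 'C(#|E|, m))%:R.
  rewrite /avg natrM invfM mulrA; congr (_ / _); last by rewrite card_draws_bin.
  by rewrite mulr_suml; apply: eq_bigr => S /drawsP[SE <-]; rewrite card_draws_bin.
(* Both normalizers count the flags S \subset S', as the case phi = 1 shows. *)
rewrite lhs rhs sum_draws_exchange //; congr (_ / _).
have c1 : \sum_(S in draws E s) \sum_(D in draws (E :\: S) (m - s)) (1 : R)
    = ('C(#|E| - s, m - s) * 'C(#|E|, s))%:R.
  rewrite (eq_bigr (fun=> ('C(#|E| - s, m - s))%:R)) => [|S /drawsP[SE cS]].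
    by rewrite sumr_const card_draws_bin natrM mulr_natr.
  by rewrite sumr_const card_draws_bin finset.cardsDS // cS.
rewrite -c1 (@sum_draws_exchange E s m (fun _ _ => 1)) //.
rewrite (eq_bigr (fun=> ('C(m, s))%:R)) => [|S /drawsP[SE cS]].
  by rewrite sumr_const card_draws_bin natrM mulr_natr.
by rewrite sumr_const card_draws_bin cS.
Qed.

(** Factorial moments of the hypergeometric law. The left binomial counts the j-subsets J of A
    contained in S; exchanging J and S leaves the chance that a random J lies in A. *)
Lemma avg_bin_card_setI E A s j : A \subset E -> (j <= s <= #|E|)%N ->
  avg E s (fun S => 'C(#|A :&: S|, j)%:R)
  = 'C(s, j)%:R * ('C(#|A|, j)%:R / 'C(#|E|, j)%:R).
Proof.
move=> AE /andP[js sE].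
have := @avg_exchange E j s (fun J _ => (J \subset A)%:R).
rewrite js sE => /(_ isT).
have -> : avg E j (fun J => avg (E :\: J) (s - j) (fun=> (J \subset A)%:R))
    = 'C(#|A|, j)%:R / 'C(#|E|, j)%:R.
  transitivity (avg E j (fun J => (J \subset A)%:R)).
    apply: eq_avg => J /drawsP[JE cJ]; rewrite avg_cst // finset.cardsDS // cJ.
    by rewrite leq_sub2r.
  rewrite /avg sum_indicator -[in RHS]card_draws_bin card_draws_bin; congr (_ / _).
  congr (_ %:R); apply: eq_card => J.
  rewrite !inE /=; case JA: (J \subset A); rewrite ?andbF ?andbT //.
  by rewrite (fintype.subset_trans JA AE).
move=> ->; rewrite -avgZ; apply: eq_avg => S /drawsP[SE cS].
rewrite /avg card_draws_bin cS mulrCA mulfV ?mulr1; last first.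
  by rewrite pnatr_eq0 -lt0n bin_gt0.
rewrite sum_indicator -card_draws_bin; congr (_ %:R).
apply: eq_card => J; rewrite !inE /= finset.subsetI.
by case: (J \subset A); case: (J \subset S); case: (#|J| == j).
Qed.

(** The ratio is a product of factors (a - i) / (N - i), each at most a / N. *)
Lemma bin_ratio_le (a N j : nat) : (a <= N)%N -> (0 < N)%N -> (j <= N)%N ->
  'C(a, j)%:R / 'C(N, j)%:R <= (a%:R / N%:R) ^+ j :> R.
Proof.
move=> aN N0; elim: j => [|j IH] jN; first by rewrite !bin0 divff // oner_neq0.
have [ja|aj] := leqP a j.
  by rewrite bin_small // mul0r exprn_ge0 // divr_ge0 ?ler0n.
have j1 : (j.+1)%:R != 0 :> R by rewrite pnatr_eq0.
have eqC b : (j < b)%N -> 'C(b, j.+1)%:R = (b - j)%:R / (j.+1)%:R * 'C(b, j)%:R :> R.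
  by move=> jb; apply: (mulfI j1); rewrite -natrM mul_bin_left natrM; field.
have Cn0 : 'C(N, j)%:R != 0 :> R by rewrite pnatr_eq0 -lt0n bin_gt0 ltnW.
have Nj0 : (N - j)%:R != 0 :> R by rewrite pnatr_eq0 subn_eq0 -ltnNge.
rewrite !eqC // exprS.
have -> : (a - j)%:R / (j.+1)%:R * 'C(a, j)%:R / ((N - j)%:R / (j.+1)%:R * 'C(N, j)%:R)
  = ((a - j)%:R / (N - j)%:R) * ('C(a, j)%:R / 'C(N, j)%:R) :> R.
  by field; rewrite Cn0 Nj0 addrC natr1 j1.
apply: ler_pM; rewrite ?divr_ge0 ?ler0n ?IH ?(ltnW jN) //.
rewrite ler_pdivrMr ?ltr0n ?subn_gt0 // mulrAC ler_pdivlMr ?ltr0n //.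
by rewrite -!natrM ler_nat; nia.
Qed.

(* Sampling without replacement is dominated by sampling with replacement. *)
Lemma avg_expr_card_setI E A s (w : R) :
  A \subset E -> (s <= #|E|)%N -> (0 < #|E|)%N -> 0 <= w ->
  avg E s (fun S => (1 + w) ^+ #|A :&: S|) <= (1 + w * (#|A|%:R / #|E|%:R)) ^+ s.
Proof.
move=> AE sE E0 w0.
(* Expanding in powers of [w] reduces the claim to factorial moments, which are compared term by
   term because the coefficients [w ^+ j] are nonnegative. *)
have -> : avg E s (fun S => (1 + w) ^+ #|A :&: S|)
  = avg E s (fun S => \sum_(j < s.+1) w ^+ j * 'C(#|A :&: S|, j)%:R).
  apply: eq_avg => S /drawsP[SE cS]; set h := #|A :&: S|.
  have hs : (h <= s)%N by rewrite -cS subset_leq_card // finset.subsetIr.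
  rewrite exprDn (eq_bigr (fun j : 'I_h.+1 => w ^+ j * 'C(h, j)%:R)); last first.
    by move=> j _; rewrite expr1n mul1r mulr_natr.
  rewrite (big_ord_widen s.+1 (fun j => w ^+ j * 'C(h, j)%:R)) //.
  rewrite big_mkcond; apply: eq_bigr => j _; case: ltnP => // hj.
  by rewrite bin_small // mulr0.
rewrite avg_sum exprDn; apply: ler_sum => j _.
have js : (j <= s)%N by rewrite -ltnS ltn_ord.
rewrite avgZ avg_bin_card_setI ?js // expr1n mul1r exprMn -[leRHS]mulr_natr.
rewrite -mulrA ler_wpM2l ?exprn_ge0 // mulrC ler_wpM2r ?ler0n //.
by rewrite bin_ratio_le // ?subset_leq_card // (leq_trans js).
Qed.

End Average.

(** * Hypergeometric tails *)

Section Hoeffding.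
Variable R : realType.
Implicit Types (p l t : R).

(** Moment generating function of a Bernoulli variable of parameter [p]. *)
Let den p l : R := 1 - p + p * expR l.

Let den_gt0 p l : 0 <= p <= 1 -> 0 < den p l.
Proof.
move=> /andP[p0 p1]; rewrite /den; have e0 := expR_gt0 l.
by have [p1'|p1'] := ltP p 1; nra.
Qed.

Let is_derive_den p l : is_derive l 1 (den p) (p * expR l).
Proof.
by apply: is_derive_eq; rewrite /GRing.scale /=; ring.
Qed.

Let score p l : R := p + l / 4 - 1 + (1 - p) / den p l.

Let is_derive_score p l : 0 <= p <= 1 ->
  is_derive l 1 (score p) (4^-1 - (1 - p) * (p * expR l) / den p l ^+ 2).
Proof.
move=> p01; have d0 : den p l != 0 by rewrite gt_eqF // den_gt0.
have dV := is_deriveV d0 (is_derive_den p l).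
apply: is_derive_eq; rewrite /GRing.scale /=; field.
by rewrite d0.
Qed.

(** The score vanishes at 0, and its derivative is 1/4 - t (1 - t) with t = p e^l / den, which is
    nonnegative. *)
Let score_ge0 p l : 0 <= p <= 1 -> 0 <= l -> 0 <= score p l.
Proof.
move=> p01 l0.
have ds y := is_derive_score y p01.
have <- : score p 0 = 0 by rewrite /score /den expR0 mul0r mulr1 subrK divr1; ring.
apply: (@ger0_derive1_ndecr _ (score p) 0 l) => //.
- move=> y _; rewrite derive1E derive_val subr_ge0.
  have D0 := den_gt0 y p01.
  rewrite ler_pdivrMr ?exprn_gt0 // /den.
  by have := sqr_ge0 (1 - p - p * expR y); nra.
- apply: continuous_subspaceT => y.
  exact/differentiable_continuous/derivable1_diffP.
Qed.

(* The derivative of log (1 - p + p e^l) - p l - l^2 / 8 is [- score p l]. *)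
Lemma hoeffding_bernoulli p l : 0 <= p <= 1 -> 0 <= l ->
  1 - p + p * expR l <= expR (p * l + l ^+ 2 / 8).
Proof.
move=> p01 l0.
(* Monotonicity is shown for the ratio of the two sides, which avoids the logarithm. *)
pose G (y : R) : R := den p y * expR (- (p * y + y ^+ 2 / 8)).
have dG (y : R) : is_derive y 1 G (- (G y * score p y)).
  have d0 : den p y != 0 by rewrite gt_eqF // den_gt0.
  apply: is_derive_eq; rewrite /GRing.scale /= /G /score.
  have -> : p * expR y = den p y - (1 - p) by rewrite /den; ring.
  by field; rewrite d0.
have : G l <= G 0.
  apply: (@ler0_derive1_nincr _ G 0 l) => //.
  - move=> y; rewrite in_itv /= => /andP[y0 _].
    rewrite derive1E derive_val oppr_le0 mulr_ge0 ?score_ge0 ?(ltW y0) //.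
    by rewrite mulr_ge0 ?expR_ge0 // ltW // den_gt0.
  - apply: continuous_subspaceT => y.
    exact/differentiable_continuous/derivable1_diffP.
rewrite /G /den mulr0 expr0n mul0r addr0 oppr0 expR0 !mulr1 subrK.
by rewrite expRN ler_pdivrMr ?expR_gt0 // mul1r.
Qed.

(** Chernoff's method: an exponential dominates the indicator, and [hoeffding_bernoulli] bounds each
    of the s factors of the binomial generating function. *)
Lemma hypergeometric_upper_tail (I : finType) (E A : {set I}) s t :
  A \subset E -> (0 < s <= #|E|)%N -> 0 <= t ->
  avg E s (fun S => (s%:R * (#|A|%:R / #|E|%:R) + t <= #|A :&: S|%:R)%R%:R)
  <= expR (- (2 * t ^+ 2 / s%:R)).
Proof.
move=> AE /andP[s0 sE] t0; have E0 := leq_trans s0 sE.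
set p := #|A|%:R / #|E|%:R; have s0' : 0 < s%:R :> R by rewrite ltr0n.
have p01 : 0 <= p <= 1.
  rewrite divr_ge0 ?ler0n //= ler_pdivrMr ?ltr0n // mul1r ler_nat.
  exact: subset_leq_card.
(* This [l] minimizes the exponent s l^2 / 8 - l t. *)
pose l := 4 * t / s%:R; have l0 : 0 <= l by rewrite divr_ge0 ?ler0n // mulr_ge0.
pose w := expR l - 1; have w0 : 0 <= w by rewrite subr_ge0 -expR0 ler_expR.
have w1 : 1 + w = expR l by rewrite /w addrC subrK.
have := avg_expr_card_setI AE sE E0 w0; rewrite -/p w1 => mgf.
pose c := expR (- (l * (s%:R * p + t))).
apply: (@le_trans _ _ (c * avg E s (fun S => expR l ^+ #|A :&: S|))).
  rewrite -avgZ; apply: ler_avg => S _; rewrite /c -expRM_natr -expRD.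
  case: (lerP (s%:R * p + t)) => h /=; last exact: expR_ge0.
  by rewrite -[leLHS]expR0 ler_expR addrC -mulrBr mulr_ge0 // subr_ge0.
apply: (@le_trans _ _ (c * expR (p * l + l ^+ 2 / 8) ^+ s)).
  rewrite ler_wpM2l ?expR_ge0 //; apply: le_trans mgf _.
  apply: lerXn2r; rewrite ?nnegrE ?expR_ge0 //.
    by rewrite addr_ge0 // mulr_ge0 //; case/andP: p01.
  apply: le_trans (hoeffding_bernoulli p01 l0).
  by rewrite /w le_eqVlt; apply/orP; left; apply/eqP; ring.
rewrite -expRM_natr -expRD ler_expR le_eqVlt /l; apply/orP; left; apply/eqP.
by field; rewrite gt_eqF.
Qed.

(** The lower tail of [A] is the upper tail of its complement in [E]. *)
Lemma hypergeometric_lower_tail (I : finType) (E A : {set I}) s t :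
  A \subset E -> (0 < s <= #|E|)%N -> 0 <= t ->
  avg E s (fun S => (#|A :&: S|%:R <= s%:R * (#|A|%:R / #|E|%:R) - t)%R%:R)
  <= expR (- (2 * t ^+ 2 / s%:R)).
Proof.
move=> AE /andP[s0 sE] t0; have E0 := leq_trans s0 sE.
have E0' : #|E|%:R != 0 :> R by rewrite pnatr_eq0 -lt0n.
have AE' : E :\: A \subset E by apply: finset.subsetDl.
have := hypergeometric_upper_tail AE' _ t0 => /(_ s); rewrite s0 sE => /(_ isT).
apply: le_trans; apply: ler_avg => S /drawsP[SE cS].
rewrite ler_nat leq_eqVlt; apply/orP; left; apply/eqP; congr (nat_of_bool _).
have cA := subset_leq_card AE.
have -> : #|(E :\: A) :&: S| = (s - #|A :&: S|)%N.
  rewrite -cS (finset.setIC A) -cardsD; apply: eq_card => y; rewrite !inE.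
  by case: (boolP (y \in S)) => [/(fintype.subsetP SE)->|]; rewrite ?andbF ?andbT.
have hs : (#|A :&: S| <= s)%N by rewrite -cS subset_leq_card // finset.subsetIr.
rewrite cardsDS // !natrB // mulrBl divff //.
by apply/idP/idP => h; lra.
Qed.

End Hoeffding.

(** * Order statistics and lower sets *)

Section LowerSets.
Context (d : Order.disp_t) (T : orderType d) (I : finType) (x : I -> T).
Implicit Types (A B D S N : {set I}) (u v y z : I) (i j : nat).

(** A minimal element of the complement is added at each step. Ties are broken arbitrarily, but the
    size grows by exactly one. *)
Lemma lower_set_exists S j : (j <= #|S|)%N ->
  exists A, [&& A \subset S, #|A| == j
    & [forall y in A, forall z in S :\: A, (x y <= x z)%O]].
Proof.
elim: j => [|j IH] jS.
  exists finset.set0; rewrite finset.sub0set cards0 eqxx /=.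
  by apply/forall_inP => y; rewrite inE.
have [A /and3P[AS /eqP cA /forall_inP lowA]] := IH (ltnW jS).
have [y0 y0SA] : exists y, y \in S :\: A.
  by apply/finset.set0Pn; rewrite -card_gt0 cardsDS // cA subn_gt0.
case: (arg_minP x y0SA) => m /finset.setDP[mS mA] minm.
exists (m |: A); apply/and3P; split.
- by rewrite finset.subUset finset.sub1set mS.
- by rewrite cardsU1 mA cA.
apply/forall_inP => y /setU1P yA; apply/forall_inP => z.
rewrite !inE negb_or -andbA => /and3P[zm zA zS].
case: yA => [->|yA]; first by apply: minm; apply/finset.setDP.
by move/forall_inP: (lowA y yA); apply; rewrite inE zA.
Qed.

(** The default value occurs only for [j] larger than [#|S|]. *)
Definition lower_set S j : {set I} :=
  odflt finset.set0 [pick A : {set I} | [&& A \subset S, #|A| == j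
    & [forall y in A, forall z in S :\: A, (x y <= x z)%O]]].

Lemma lower_setP S j : (j <= #|S|)%N ->
  [/\ lower_set S j \subset S, #|lower_set S j| = j
    & forall y z, y \in lower_set S j -> z \in S -> z \notin lower_set S j ->
        (x y <= x z)%O].
Proof.
move=> /lower_set_exists[A0 PA0]; rewrite /lower_set.
case: pickP => [A /and3P[AS /eqP cA /forall_inP lowA]|/(_ A0)]; last by rewrite PA0.
split=> // y z /= yA zS zA; move/forall_inP: (lowA y yA); apply.
by rewrite inE zA.
Qed.

Lemma ith_smallestP S i y : (0 < i)%N -> reflect
  [/\ y \in S, (#|[set z in S | (x z < x y)%O]| < i)%N
    & (i <= #|[set z in S | (x z <= x y)%O]|)%N] (ith_smallest x S i y).
Proof.
move=> i0; apply: (iffP and3P) => -[yS h1 h2]; split => //; lia.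
Qed.

Lemma ith_smallest_mono S i j u v : (0 < i <= j)%N ->
  ith_smallest x S i u -> ith_smallest x S j v -> (x u <= x v)%O.
Proof.
move=> /andP[i0 ij] /(ith_smallestP _ _ i0)[uS ui _].
move=> /(ith_smallestP _ _ (leq_trans i0 ij))[vS _ vj]; rewrite leNgt.
apply/negP => vu; have : (#|[set z in S | (x z <= x v)%O]|
                   <= #|[set z in S | (x z < x u)%O]|)%N.
  apply: subset_leq_card; apply/fintype.subsetP => z; rewrite !inE.
  by move=> /andP[-> /le_lt_trans]; apply.
by lia.
Qed.

(** * Ranks in N of an order statistic of a subsample *)

Section Sample.
Variables (N S : {set I}) (i j : nat) (u : I).
Hypotheses (SN : S \subset N) (jN : (j <= #|N|)%N) (i_gt0 : (0 < i)%N).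
Hypothesis ui : ith_smallest x S i u.
Let A := lower_set N j.

Let card_lowerD : #|A :&: S| + #|A :&: (N :\: S)| = j.
Proof.
have [AN cA _] := lower_setP jN; rewrite -cA -/A -(cardsID S A); congr addn.
apply: eq_card => y; rewrite !inE.
case: (boolP (y \in A)) => [yA|_]; last by rewrite andbF.
by rewrite (fintype.subsetP AN _ yA) !andbT.
Qed.

(** At least [i] elements of S are at most [u], so one of them lies outside [A]. Hence all of [A] is
    at most [u], that element is an additional one, and the elements of [N :\: S] above [u] avoid
    [A]. *)
Lemma lower_set_lt_rank : (#|A :&: S| < i)%N ->
  (j < #|[set y in N | (x y <= x u)%O]|)%N /\
  (#|[set y in N :\: S | (x u < x y)%O]| + j < #|N :\: S| + i)%N.
Proof.
move=> ASi; have [AN cA lowA] := lower_setP jN.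
case/(ith_smallestP _ _ i_gt0): ui => uS _ iu.
have /existsP[y0 /and3P[y0S y0A y0u]] :
    [exists y, [&& y \in S, y \notin A & (x y <= x u)%O]].
  apply: contraLR (leq_trans ASi iu).
  rewrite negb_exists -leqNgt => /forallP h; apply: subset_leq_card.
  apply/fintype.subsetP => z; rewrite !inE => /andP[zS zu]; rewrite zS andbT.
  by apply/negPn/negP => zA; move: (h z); rewrite zS zA zu.
have y0N := fintype.subsetP SN _ y0S.
have Au y : y \in A -> (x y <= x u)%O.
  by move=> yA; apply: le_trans (lowA _ _ yA y0N y0A) y0u.
split.
  rewrite -cA; apply: proper_card; apply/fintype.properP; split.
    by apply/fintype.subsetP => y yA; rewrite inE Au // (fintype.subsetP AN _ yA).
  by exists y0 => //; rewrite inE y0N.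
have : (#|[set y in N :\: S | (x u < x y)%O]| + #|A :&: (N :\: S)| <= #|N :\: S|)%N.
  rewrite addnC -leq_subRL; last by rewrite subset_leq_card // finset.subsetIr.
  rewrite -cardsDS ?finset.subsetIr //; apply: subset_leq_card.
  apply/fintype.subsetP => y; rewrite !inE => /andP[-> uy].
  by rewrite !andbT; apply/negP => /Au; rewrite leNgt uy.
by have := card_lowerD; lia.
Qed.

(** Dually, fewer than [i] elements of S are below [u], so some element of [A :&: S] is at least
    [u]; everything below [u] then lies in [A], and that element is not below [u]. *)
Lemma lower_set_ge_rank : (i <= #|A :&: S|)%N ->
  (#|[set y in N | (x y < x u)%O]| < j)%N /\
  (#|[set y in N :\: S | (x y < x u)%O]| + i <= j)%N.
Proof.
move=> ASi; have [AN cA lowA] := lower_setP jN.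
case/(ith_smallestP _ _ i_gt0): ui => uS iu _.
have /existsP[y0 /and3P[y0S y0A y0u]] :
    [exists y, [&& y \in S, y \in A & (x u <= x y)%O]].
  apply: contraLR (leq_trans iu ASi).
  rewrite negb_exists -leqNgt => /forallP h; apply: subset_leq_card.
  apply/fintype.subsetP => z; rewrite !inE => /andP[zA zS]; rewrite zS /=.
  by rewrite ltNge; apply/negP => zu; move: (h z); rewrite zS zA zu.
have Au y : y \in N -> (x y < x u)%O -> y \in A.
  move=> yN; apply: contraLR => yA; rewrite -leNgt.
  by apply: le_trans y0u (lowA _ _ y0A yN yA).
split.
  rewrite -cA; apply: proper_card; apply/fintype.properP; split.
    by apply/fintype.subsetP => y; rewrite inE => /andP[yN]; apply: Au.
  by exists y0 => //; rewrite inE ltNge y0u andbF.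
have : (#|[set y in N :\: S | (x y < x u)%O]| <= #|A :&: (N :\: S)|)%N.
  apply: subset_leq_card; apply/fintype.subsetP => y; rewrite !inE.
  by move=> /andP[/andP[-> yN] /(Au _ yN) ->].
by have := card_lowerD; lia.
Qed.

End Sample.

(** [N] splits into [B] below [S], [S] itself and a rest above [S], so ranks shift by [#|B|]. This
    justifies passing only one block of the partition to the subroutine. *)
Lemma ith_smallest_slice N S B i y : B \subset N -> S \subset N -> (0 < i)%N ->
  {in B & S, forall b s, (x b < x s)%O} ->
  (forall z s, z \in N -> z \notin B -> z \notin S -> s \in S -> (x s < x z)%O) ->
  ith_smallest x S i y -> ith_smallest x N (#|B| + i) y.
Proof.
move=> BN SN i0 BS SC /(ith_smallestP _ _ i0)[yS h1 h2].
apply/ith_smallestP; first lia.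
have dBS : [disjoint B & S]%B.
  apply/pred0P => z /=; apply/negbTE/negP => /andP[zB zS].
  by have := BS _ _ zB zS; rewrite ltxx.
split; first exact: (fintype.subsetP SN).
  apply: (@leq_trans #|B :|: [set z in S | (x z < x y)%O]|.+1).
    rewrite ltnS; apply: subset_leq_card; apply/fintype.subsetP => z; rewrite !inE.
    move=> /andP[zN zy]; case: (boolP (z \in B)) => //= zB.
    rewrite zy andbT; apply/negPn/negP => zS.
    by have := lt_trans (SC _ _ zN zB zS yS) zy; rewrite ltxx.
  by apply: leq_trans (leq_add (leqnn _) h1); rewrite addnS ltnS leq_card_setU.
apply: leq_trans (leq_add (leqnn _) h2) _.
have /eqP <- : #|B :|: [set z in S | (x z <= x y)%O]|
    == (#|B| + #|[set z in S | (x z <= x y)%O]|)%N.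
  rewrite (leq_card_setU _ _).2; apply/pred0P => z /=; rewrite inE.
  by move/pred0P/(_ z): dBS => /=; case: (z \in B) => //= ->.
apply: subset_leq_card; apply/fintype.subsetP => z; rewrite !inE.
move=> /orP[zB|/andP[zS ->]]; last by rewrite (fintype.subsetP SN _ zS).
by rewrite (fintype.subsetP BN _ zB) /= ltW // BS.
Qed.

End LowerSets.

(** * Selecting the next pivots from the partition *)

Section NextPivot.
Context (R : realType) (d : Order.disp_t) (T : orderType d) (n : nat).
Variables (x : 'I_n -> T) (gammaP : R) (sel : {set 'I_n} -> nat -> dtree 'I_n).
Hypotheses (gammaP0 : 0 <= gammaP) (Hsel : selection_subroutine T gammaP sel).
Implicit Types (N S : {set 'I_n}) (u v y z : 'I_n) (i : nat).

Definition below N u : {set 'I_n} := [set y in N | (x y < x u)%O].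
Definition upto N u : {set 'I_n} := [set y in N | (x y <= x u)%O].
Definition above N v : {set 'I_n} := [set y in N | (x v < x y)%O].
Definition between N u v : {set 'I_n} :=
  [set y in N | (x u < x y)%O && (x y < x v)%O].

Lemma card_above N v : #|above N v| = (#|N| - #|upto N v|)%N.
Proof.
rewrite -cardsDS; last by apply/fintype.subsetP => y; rewrite inE => /andP[].
by apply: eq_card => y; rewrite !inE; case: (y \in N); rewrite //= ?andbT -ltNge.
Qed.

(** The conditional is the size of the block handed to the subroutine. The blocks L, R and M are
    slices over the lower parts [set0], [upto N v] and [upto N u]; when the target is [u] or [v]
    itself, the cost is zero. *)
Lemma next_pivotP N u v i :
  u \in N -> v \in N -> (x u <= x v)%O -> (0 < i <= #|N|)%N ->
  ith_smallest x N i (next_pivot x sel N u v i).1 /\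
  (next_pivot x sel N u v i).2%:R <= gammaP *
    (if (i <= #|below N u|)%N then #|below N u|
     else if (#|upto N v| < i)%N then #|above N v| else #|between N u v|)%:R.
Proof.
move=> uN vN uv /andP[i0 iN]; rewrite /next_pivot.
have -> : [set y in N | (x y < x u)%O] :|: [set y in N | x y == x u] = upto N u.
  by apply/setP => y; rewrite !inE -andb_orr orbC -le_eqVlt.
rewrite -/(below N u) -/(above N v) -/(between N u v).
have -> : (#|N| - #|above N v|)%N = #|upto N v|.
  rewrite card_above subKn // subset_leq_card //.
  by apply/fintype.subsetP => y; rewrite inE => /andP[].
case: ifP => [/andP[iL iLU]|notU] /=.
  split; last by rewrite mulr_ge0 ?ler0n.
  by apply/(ith_smallestP _ _ _ i0).
case: ifP => [/andP[iM iV]|notV] /=.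
  split; last by rewrite mulr_ge0 ?ler0n.
  apply/(ith_smallestP _ _ _ i0); split => //; apply: leq_ltn_trans iM.
  apply: subset_leq_card; apply/fintype.subsetP => y; rewrite !inE.
  by move=> /andP[-> ->]; rewrite /= andbT; case: leP.
have ith_sel S (B : {set 'I_n}) j : B \subset N -> S \subset N -> i = (#|B| + j)%N ->
    (0 < j <= #|S|)%N -> {in B & S, forall b s, (x b < x s)%O} ->
    (forall z s, z \in N -> z \notin B -> z \notin S -> s \in S -> (x s < x z)%O) ->
    ith_smallest x N i (dtree_run x (sel S j)).1 /\
    (dtree_run x (sel S j)).2%:R <= gammaP * #|S|%:R.
  move=> BN SN -> /andP[j0 jS] BS SC; have [|h1 h2] := Hsel x (S := S) (i := j).
    by rewrite j0.
  by split=> //; apply: ith_smallest_slice BN SN j0 BS SC h1.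
have subN (P : pred 'I_n) : [set y in N | P y] \subset N.
  by apply/fintype.subsetP => y; rewrite inE => /andP[].
case: ifP => [iL|iL].
  apply: (ith_sel _ finset.set0); rewrite ?finset.sub0set ?cards0 ?i0 ?subN //.
    by move=> b s; rewrite inE.
  by move=> z s zN _; rewrite !inE zN /= -leNgt => uz /andP[_ su]; apply: lt_le_trans uz.
have cU := card_above N v; have sU := subset_leq_card (subN (fun y => x y <= x v)%O).
case: ifP => [iV|iV].
  apply: (ith_sel _ (upto N v)); rewrite ?subN //.
  - by rewrite subnKC // ltnW.
  - by rewrite subn_gt0 iV cU leq_sub2r.
  - by move=> b s; rewrite !inE => /andP[_ bv] /andP[_]; apply: le_lt_trans.
  - move=> z s zN; rewrite !inE zN /= => h.
    by rewrite ltNge h.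
have iU : (#|upto N u| < i)%N by rewrite ltnNge; apply/negP => h; rewrite h ltnNge iL in notU.
apply: (ith_sel _ (upto N u)); rewrite ?subN //.
- by rewrite subnKC // ltnW.
- rewrite subn_gt0 iU /= leq_subLR.
  apply: leq_trans (leq_card_setU _ _); rewrite leqNgt; apply/negP => h.
  by rewrite h leqNgt iV in notV.
- by move=> b s; rewrite !inE => /andP[_ bu] /and3P[_ us _]; apply: le_lt_trans bu us.
- move=> z s zN; rewrite !inE zN /= -!ltNge => uz; rewrite uz /= -leNgt => vz.
  by case/and3P=> _ _ sv; apply: lt_le_trans sv vz.
Qed.

Lemma next_pivot_cost_max N u v i :
  u \in N -> v \in N -> (x u <= x v)%O -> (0 < i <= #|N|)%N ->
  (next_pivot x sel N u v i).2%:R <= gammaP * #|N|%:R.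
Proof.
move=> uN vN uv iN; have [_] := next_pivotP uN vN uv iN; move/le_trans; apply.
rewrite ler_wpM2l // ler_nat; do 2?case: ifP => _; apply: subset_leq_card;
by apply/fintype.subsetP => y; rewrite inE => /andP[].
Qed.

End NextPivot.

(** * One step of the algorithm *)

Section Ranks.
Variable R : realType.
Implicit Types (a b : R) (s : nat).

(** [rank_u] and [rank_v] are convertible to [lower_rank] and [upper_rank] at theta s_l - g_l and
    theta s_l + g_l. *)
Definition lower_rank a : nat := `|Num.max (Num.ceil a) 1|%N.
Definition upper_rank a s : nat := `|Num.min (Num.ceil a) s%:Z|%N.

Let lower_rankE a : (lower_rank a)%:Z = Num.max (Num.ceil a) 1.
Proof. by rewrite /lower_rank gez0_abs // le_max ler01 orbT. Qed.

Let upper_rankE a s : 0 < a -> (upper_rank a s)%:Z = Num.min (Num.ceil a) s%:Z.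
Proof. by move=> a0; rewrite /upper_rank gez0_abs // le_min ltW ?ceil_gt0. Qed.

Let natrZ (k : nat) : k%:R = (k%:Z)%:~R :> R. Proof. by []. Qed.

Lemma lower_rank_gt0 a : (0 < lower_rank a)%N.
Proof. by rewrite -ltz_nat lower_rankE lt_max ltr01 orbT. Qed.

Lemma lower_rank_ge a : a <= (lower_rank a)%:R.
Proof.
by rewrite natrZ lower_rankE; apply: le_trans (ceil_ge a) _; rewrite ler_int le_max lexx.
Qed.

Lemma lower_rank_lt a : 0 < a -> (lower_rank a)%:R < a + 1.
Proof.
move=> a0; rewrite natrZ lower_rankE max_l; last by rewrite -gtz0_ge1 ceil_gt0.
by have := ceilB1_lt a; rewrite intrB; lra.
Qed.

Lemma lower_rank_le0 a : a <= 0 -> lower_rank a = 1%N.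
Proof.
by move=> a0; apply/eqP; rewrite -eqz_nat lower_rankE max_r // (@le_trans _ _ 0) // ceil_le0.
Qed.

Lemma upper_rank_le a s : 0 < a -> (upper_rank a s <= s)%N.
Proof. by move=> a0; rewrite -lez_nat upper_rankE // ge_min lexx orbT. Qed.

Lemma upper_rank_gt0 a s : 0 < a -> (0 < s)%N -> (0 < upper_rank a s)%N.
Proof. by move=> a0 s0; rewrite -ltz_nat upper_rankE // lt_min ceil_gt0 a0. Qed.

Lemma upper_rank_lt a s : 0 < a -> (upper_rank a s)%:R < a + 1.
Proof.
move=> a0; apply: (@le_lt_trans _ _ (Num.ceil a)%:~R).
  by rewrite natrZ upper_rankE // ler_int ge_min lexx.
by have := ceilB1_lt a; rewrite intrB; lra.
Qed.

Lemma upper_rank_ge a s : 0 < a -> a <= s%:R -> a <= (upper_rank a s)%:R.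
Proof.
move=> a0 as_; rewrite natrZ upper_rankE // min_l ?ceil_ge //.
by rewrite ceil_le_int.
Qed.

Lemma upper_rank_max a s : s%:R < a -> upper_rank a s = s.
Proof.
move=> sa; have a0 : 0 < a by apply: le_lt_trans sa.
apply/eqP; rewrite -eqz_nat upper_rankE // min_r //.
by rewrite -(ler_int R); apply: le_trans (ltW sa) (ceil_ge _).
Qed.

Lemma lower_rank_le_rkv a b s : a <= b -> 0 < b -> a <= s%:R -> (0 < s)%N ->
  (lower_rank a <= upper_rank b s)%N.
Proof.
move=> ab b0 as_ s0; rewrite -lez_nat lower_rankE upper_rankE // ge_max !le_min.
by rewrite le_ceil // ceil_le_int // as_ -!gtz0_ge1 ceil_gt0 b0.
Qed.

End Ranks.

Section Step.
Context (R : realType) (d : Order.disp_t) (T : orderType d) (n : nat).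
Variables (x : 'I_n -> T) (gammaP : R) (sel : {set 'I_n} -> nat -> dtree 'I_n).
Hypotheses (gammaP0 : 0 <= gammaP) (Hsel : selection_subroutine T gammaP sel).
Implicit Types (N S : {set 'I_n}) (u v y z : 'I_n) (i : nat).

(* [th] is theta, [g] and [g'] are the gaps at the sample sizes [s] <= [m]. *)
Variables (th g g' kappa : R) (s m : nat).
Hypotheses (th01 : 0 < th <= 1) (g_ge : 2^-1 <= g) (s_gt0 : (0 < s)%N).
Hypothesis (sm : (s <= m)%N).
Hypotheses (g'0 : 0 <= g') (kappa01 : 0 <= kappa <= 1).

(** The gap of the sample of size [s], expressed in ranks of the next sample of size [m]. *)
Definition scaled_gap : R := g * m%:R / s%:R.
Hypothesis g'_le : g' <= kappa * scaled_gap.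

Let G := scaled_gap.
Let a := th * s%:R - g.
Let b := th * s%:R + g.
Let a' := th * m%:R - g'.
Let b' := th * m%:R + g'.
Let iu := lower_rank a.
Let iv := upper_rank b s.
Let iu' := lower_rank a'.
Let iv' := upper_rank b' m.
(** Outer marks for the pivots, at distance 2 G from th m: one G because the pivot ranks are shifted
    by g, another as the deviation in the tail bound. The predecessor puts [kl] strictly below th m
    - 2 G unless it is 0. [low_u] and [high_v] are the events that a pivot may escape beyond its
    mark. *)
Let kl := (lower_rank (th * m%:R - 2 * G)).-1.
Let kr := upper_rank (th * m%:R + 2 * G) m.

(* When the rank of u (resp. v) in S is truncated to 1 (resp. s), the pivot u
   (resp. v) may well be on the wrong side of its target, but then the part of
   N lying beyond it is small; hence the guards in [bad_u] and [bad_v]. *)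
Definition low_u N S : bool := (iu <= #|lower_set x N kl :&: S|)%N.
Definition high_v N S : bool := (#|lower_set x N kr :&: S| < iv)%N.
Definition bad_u N S : bool := (0 < a) && (#|lower_set x N iu' :&: S| < iu)%N.
Definition bad_v N S : bool :=
  (b <= s%:R) && (iv <= #|lower_set x N iv'.-1 :&: S|)%N.
Definition some_bad N S : bool := [|| low_u N S, high_v N S, bad_u N S | bad_v N S].

Let s0 : 0 < s%:R :> R. Proof. by rewrite ltr0n. Qed.
Let m0 : 0 < m%:R :> R. Proof. by rewrite ltr0n (leq_trans s_gt0). Qed.
Let th0 : 0 < th. Proof. by case/andP: th01. Qed.
Let th1 : th <= 1. Proof. by case/andP: th01. Qed.
Let g0 : 0 < g. Proof. by apply: lt_le_trans g_ge; rewrite invr_gt0. Qed.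
Let gG : g <= G.
Proof. by rewrite /G /scaled_gap -mulrA ler_peMr ?(ltW g0) // ler_pdivlMr // mul1r ler_nat. Qed.
Let G0 : 0 < G. Proof. exact: lt_le_trans gG. Qed.
Let GE : G * s%:R = g * m%:R. Proof. by rewrite /G /scaled_gap mulfVK // gt_eqF. Qed.
Let b0 : 0 < b. Proof. by rewrite addr_gt0 // mulr_gt0. Qed.
Let b'0 : 0 < b'. Proof. by rewrite ltr_pwDl // mulr_gt0. Qed.
Let br0 : 0 < th * m%:R + 2 * G. Proof. by rewrite addr_gt0 // mulr_gt0. Qed.
Let ths : th * s%:R <= s%:R. Proof. by rewrite ler_piMl // ltW. Qed.
Let thm : th * m%:R <= m%:R. Proof. by rewrite ler_piMl // ltW. Qed.
Let iu0 : (0 < iu)%N. Proof. exact: lower_rank_gt0. Qed.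
Let iv0 : (0 < iv)%N. Proof. exact: upper_rank_gt0. Qed.
Let iu'm : (iu' <= m)%N.
Proof.
apply: leq_trans (upper_rank_le m m0); apply: lower_rank_le_rkv => //.
- by rewrite /a' lerBlDr (le_trans thm) // lerDl.
- by rewrite /a' lerBlDr (le_trans thm) // lerDl.
- exact: leq_trans sm.
Qed.
Let iv'm : (iv' <= m)%N. Proof. exact: upper_rank_le. Qed.
Let kr_le : (kr <= m)%N. Proof. exact: upper_rank_le. Qed.
Let kl_le : (kl <= m)%N.
Proof.
apply: leq_trans (leq_pred _) _; apply: leq_trans (upper_rank_le m m0); apply: lower_rank_le_rkv => //.
- by rewrite lerBlDr (le_trans thm) // lerDl mulr_ge0 // ltW.
- by rewrite lerBlDr (le_trans thm) // lerDl mulr_ge0 // ltW.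
- exact: leq_trans sm.
Qed.
Let klE : kl.+1 = lower_rank (th * m%:R - 2 * G). Proof. by rewrite /kl prednK ?lower_rank_gt0. Qed.
Let kl_ge : th * m%:R - 2 * G <= kl%:R + 1.
Proof. by rewrite natr1 klE; exact: lower_rank_ge. Qed.
Let scale_s (t c : R) : t <= c * m%:R -> t * s%:R <= (c * s%:R) * m%:R.
Proof. by move=> h; rewrite mulrAC ler_wpM2r // ltW. Qed.

Lemma rank_mono : (iu <= iv)%N.
Proof.
by apply: lower_rank_le_rkv => //; rewrite /a /b; [have := ltW g0|have := ltW g0; have := ths]; lra.
Qed.

Lemma next_rank_mono : (iu' <= iv')%N.
Proof.
apply: lower_rank_le_rkv => //; rewrite /a' /b'; [|have := thm|exact: leq_trans sm]; move: g'0; lra.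
Qed.

Lemma next_rank_u_bounds : (0 < iu' <= m)%N. Proof. by rewrite lower_rank_gt0. Qed.
Lemma next_rank_v_bounds : (0 < iv' <= m)%N.
Proof. by rewrite iv'm andbT; apply: leq_trans next_rank_mono; exact: lower_rank_gt0. Qed.

(** * Costs of a step outside the failure events *)

Section Events.
Variables (N S : {set 'I_n}) (u v : 'I_n).
Hypotheses (SN : S \subset N) (cN : #|N| = m) (cS : #|S| = s).
Hypotheses (hu : ith_smallest x S iu u) (hv : ith_smallest x S iv v).

Let jN j : (j <= m)%N -> (j <= #|N|)%N. Proof. by rewrite cN. Qed.
Let cD : #|N :\: S|%:R = m%:R - s%:R :> R. Proof. by rewrite cardsDS // cN cS natrB. Qed.

(** The mark [kr] contributes th m + 2 G + 1, from which the rank of [v] in S removes th s + g. The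
    rounding unit is absorbed since g + G >= 1, which is where the lower bound 1/2 on g enters. *)
Lemma partition_below_v : ~~ high_v N S ->
  #|below x (N :\: S) v|%:R <= th * #|N :\: S|%:R + 3 * G.
Proof.
rewrite /high_v -leqNgt => h.
have [_] := lower_set_ge_rank SN (jN kr_le) iv0 hv h.
rewrite -/(below x _ v) -(ler_nat R) natrD => cnt.
have krlt := upper_rank_lt m br0; rewrite -/kr in krlt.
(* If the rank of [v] is truncated to [s], then (1 - th) s < g, and counting all of [N :\: S] is
   affordable because (1 - th) (m - s) <= G. *)
rewrite cD; have [bs|sb] := lerP b s%:R.
  by have := upper_rank_ge b0 bs; rewrite -/iv /b; move: gG g_ge; lra.
have : #|below x (N :\: S) v|%:R <= #|N :\: S|%:R :> R.
  by rewrite ler_nat subset_leq_card //; apply/fintype.subsetP => y; rewrite inE => /andP[].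
rewrite cD => le1; apply: (le_trans le1).
suff : (1 - th) * (m%:R - s%:R) <= G by move: G0; lra.
rewrite -(ler_pM2r s0) GE; apply: (@le_trans _ _ (g * (m%:R - s%:R))).
  rewrite mulrAC ler_wpM2r ?subr_ge0 ?ler_nat //.
  by move: sb; rewrite /b; lra.
by rewrite ler_pM2l // gerBl ltW.
Qed.

Lemma partition_above_u : ~~ low_u N S ->
  #|above x (N :\: S) u|%:R <= (1 - th) * #|N :\: S|%:R + 3 * G.
Proof.
rewrite /low_u -ltnNge => h.
have [_] := lower_set_lt_rank SN (jN kl_le) iu0 hu h.
rewrite -/(above x _ u) -(ler_nat R) -natr1 !natrD => cnt.
rewrite cD in cnt *; have [a0|a0] := ltP 0 a.
  by have := lower_rank_lt a0; rewrite -/iu /a; move: gG g_ge kl_ge; lra.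
have : #|above x (N :\: S) u|%:R <= #|N :\: S|%:R :> R.
  by rewrite ler_nat subset_leq_card //; apply/fintype.subsetP => y; rewrite inE => /andP[].
rewrite cD => le1; apply: (le_trans le1).
suff : th * (m%:R - s%:R) <= G by move: G0; lra.
rewrite -(ler_pM2r s0) GE; apply: (@le_trans _ _ (g * (m%:R - s%:R))).
  rewrite mulrAC ler_wpM2r ?subr_ge0 ?ler_nat //.
  by move: a0; rewrite /a; lra.
by rewrite ler_pM2l // gerBl ltW.
Qed.

(** The middle block lies between the marks, which are 4 G apart. The block below [u] is searched
    only when the rank of [u] was truncated; then th m <= G, and the block has at most th m + 2 G
    elements. The block above [v] is symmetric. *)
Lemma next_pivot_cost_good i : ~~ some_bad N S -> (iu' <= i <= iv')%N ->
  (next_pivot x sel N u v i).2%:R <= gammaP * (4 * G).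
Proof.
rewrite /some_bad !negb_or => /and4P[lowu highv badu badv] /andP[ui vi].
have uv : (x u <= x v)%O by apply: ith_smallest_mono hu hv; rewrite iu0 rank_mono.
have uN : u \in N by case/and3P: hu => uS _ _; apply: (fintype.subsetP SN).
have vN : v \in N by case/and3P: hv => vS _ _; apply: (fintype.subsetP SN).
have i0N : (0 < i <= #|N|)%N.
  by rewrite cN (leq_trans vi iv'm) andbT (leq_trans _ ui) ?lower_rank_gt0.
have [_] := next_pivotP gammaP0 Hsel uN vN uv i0N.
move/le_trans; apply; rewrite ler_wpM2l //.
have [vkr _] := lower_set_ge_rank SN (jN kr_le) iv0 hv (ltac:(by rewrite leqNgt)).
have [ukl _] := lower_set_lt_rank SN (jN kl_le) iu0 hu (ltac:(by rewrite ltnNge)).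
rewrite -/(below x N v) -(ler_nat R) -natr1 in vkr.
rewrite -/(upto x N u) -(ler_nat R) -natr1 in ukl.
have krlt := upper_rank_lt m br0; rewrite -/kr in krlt.
case: ifP => [iL|iL].
  have a0 : a <= 0.
    rewrite leNgt; apply/negP => a0; move: badu; rewrite /bad_u a0 /= -leqNgt => h.
    have [lt_below _] := lower_set_ge_rank SN (jN iu'm) iu0 hu h.
    by have := leq_trans lt_below (leq_trans ui iL); rewrite ltnn.
  have : #|below x N u|%:R <= #|below x N v|%:R :> R.
    rewrite ler_nat subset_leq_card //; apply/fintype.subsetP => y; rewrite !inE.
    by move=> /andP[-> /lt_le_trans]; apply.
  have : th * m%:R <= G.
    rewrite -(ler_pM2r s0) GE mulrAC ler_wpM2r ?(ltW m0) //.
    by move: a0; rewrite /a; lra.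
  by move: G0; lra.
case: ifP => [iV|iV].
  have sb : s%:R < b.
    rewrite ltNge; apply/negP => bs; move: badv; rewrite /bad_v bs /= -ltnNge => h.
    (* The lower set has [iv'.-1] elements, so the strict inequality yields [iv' <= #|upto N v|]. *)
    have [lt_upto _] := lower_set_lt_rank SN (jN (leq_trans (leq_pred _) iv'm)) iv0 hv h.
    have := leq_trans (leq_trans iV vi) (leqSpred iv').
    by move/leq_trans/(_ lt_upto); rewrite ltnn.
  have : #|above x N v|%:R <= m%:R - #|upto x N u|%:R :> R.
    rewrite -cN -natrB; last first.
      by rewrite subset_leq_card //; apply/fintype.subsetP => y; rewrite inE => /andP[].
    rewrite ler_nat card_above leq_sub2l // subset_leq_card //.
    apply/fintype.subsetP => y; rewrite !inE.
    by move=> /andP[-> /le_trans]; apply.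
  have : (1 - th) * m%:R <= G.
    rewrite -(ler_pM2r s0) GE mulrAC ler_wpM2r ?(ltW m0) //.
    by move: sb; rewrite /b; lra.
  by move: G0 kl_ge; lra.
(* For tied pivots [upto N u] is not contained in [below N v], but the middle block is then
   empty. *)
have [xuv|xvu] := ltP (x u) (x v); last first.
  have -> : between x N u v = finset.set0.
    apply/setP => y; rewrite !inE; apply/negbTE/negP => /andP[_ /andP[uy yv]].
    by have := lt_le_trans (lt_trans uy yv) xvu; rewrite ltxx.
  by rewrite cards0; move: G0; lra.
have : #|between x N u v|%:R + #|upto x N u|%:R <= #|below x N v|%:R :> R.
  rewrite -natrD ler_nat.
  have /eqP <- : #|between x N u v :|: upto x N u| == (#|between x N u v| + #|upto x N u|)%N.
    rewrite (leq_card_setU _ _).2; apply/pred0P => y /=; rewrite !inE.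
    by case: (y \in N) => //=; case: (leP (x y) (x u)); rewrite ?andbF.
  apply: subset_leq_card; apply/fintype.subsetP => y; rewrite !inE.
  by move=> /orP[/and3P[-> _ ->]//|/andP[-> /le_lt_trans]]; apply.
by move: G0 kl_ge; lra.
Qed.

End Events.

(** * Probabilities of the failure events *)

Section Probabilities.
Variable N : {set 'I_n}.
Hypothesis cN : #|N| = m.

Let sN : (0 < s <= #|N|)%N. Proof. by rewrite s_gt0 cN. Qed.

Let mean_le (t c : R) : t <= c * m%:R -> s%:R * (t / m%:R) <= c * s%:R.
Proof. by move=> h; rewrite mulrA ler_pdivrMr // mulrC scale_s. Qed.

Let mean_ge (t c : R) : c * m%:R <= t -> c * s%:R <= s%:R * (t / m%:R).
Proof. by move=> h; rewrite mulrA ler_pdivlMr // mulrAC mulrC ler_wpM2l // ltW. Qed.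

Let GsE : G = g / s%:R * m%:R. Proof. by rewrite /G /scaled_gap mulrAC. Qed.

(** The lower set of size [kl] meets S in at most th s - 2 g elements on average, whereas the event
    needs th s - g: a deviation of g. *)
Lemma prob_low_u : avg N s (fun S => (low_u N S)%:R) <= expR (- (2 * g ^+ 2 / s%:R)).
Proof.
have [AN cA _] := lower_setP x (ltac:(by rewrite cN) : (kl <= #|N|)%N).
apply: le_trans (hypergeometric_upper_tail AN sN (ltW g0)); apply: ler_avg => S SD.
case h : (low_u N S) => //=; rewrite cA cN.
(* When the mark is truncated to 0, the lower set is empty and the event impossible. *)
have [kl0|kl0] := posnP kl.
  have /eqP A0 : lower_set x N kl == finset.set0 by rewrite -cards_eq0 cA kl0.
  by move: h; rewrite /low_u A0 finset.set0I cards0 leqNgt iu0.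
have r0 : 0 < th * m%:R - 2 * G.
  by rewrite ltNge; apply/negP => /lower_rank_le0; rewrite -klE => -[e]; rewrite e in kl0.
have kllt := lower_rank_lt r0; rewrite -klE -natr1 in kllt.
have mean : s%:R * (kl%:R / m%:R) <= (th - 2 * (g / s%:R)) * s%:R.
  by apply: mean_le; move: kllt; rewrite GsE; lra.
rewrite mulrBl -mulrA mulfVK ?gt_eqF // in mean.
have iuge := lower_rank_ge a; rewrite -/iu /a in iuge.
have : iu%:R <= #|lower_set x N kl :&: S|%:R :> R by rewrite ler_nat.
by move=> h'; rewrite ler1n lt0b; lra.
Qed.

Lemma prob_high_v : avg N s (fun S => (high_v N S)%:R) <= expR (- (2 * g ^+ 2 / s%:R)).
Proof.
have [AN cA _] := lower_setP x (ltac:(by rewrite cN) : (kr <= #|N|)%N).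
apply: le_trans (hypergeometric_lower_tail AN sN (ltW g0)); apply: ler_avg => S SD.
have /drawsP[SN cS] := SD.
case h : (high_v N S) => //=; rewrite cA cN.
(* When the mark is truncated to [m], the lower set is all of N and the event impossible. *)
have [bm|mb] := lerP (th * m%:R + 2 * G) m%:R; last first.
  have krm : kr = m by apply: upper_rank_max.
  have AE : lower_set x N kr = N by apply/eqP; rewrite eqEcard AN cA krm cN /=.
  move: h; rewrite /high_v AE (finset.setIidPr SN) cS ltnNge => /negP; case.
  exact: upper_rank_le.
have krge := upper_rank_ge br0 bm; rewrite -/kr in krge.
have mean : (th + 2 * (g / s%:R)) * s%:R <= s%:R * (kr%:R / m%:R).
  by apply: mean_ge; move: krge; rewrite GsE; lra.
rewrite mulrDl -mulrA mulfVK ?gt_eqF // in mean.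
have ivlt := upper_rank_lt s b0; rewrite -/iv /b in ivlt.
have : #|lower_set x N kr :&: S|%:R + 1 <= iv%:R :> R by rewrite natr1 ler_nat.
by move=> h'; rewrite ler1n lt0b; lra.
Qed.

Let kg0 : 0 <= (1 - kappa) * g.
Proof. by case/andP: kappa01 => _ k1; rewrite mulr_ge0 ?subr_ge0 // ltW. Qed.

(** The lower set of size [iu'] meets S in at least th s - kappa g elements on average, by the bound
    on g', whereas the event allows at most th s - g: the margin is (1 - kappa) g. The guard 0 < a
    keeps the rounding of [iu] below one unit. *)
Lemma prob_bad_u : avg N s (fun S => (bad_u N S)%:R)
  <= expR (- (2 * ((1 - kappa) * g) ^+ 2 / s%:R)).
Proof.
have [AN cA _] := lower_setP x (ltac:(by rewrite cN) : (iu' <= #|N|)%N).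
apply: le_trans (hypergeometric_lower_tail AN sN kg0); apply: ler_avg => S SD.
case h : (bad_u N S) => //=; rewrite cA cN.
case/andP: h => a0 h.
have mean : (th - kappa * (g / s%:R)) * s%:R <= s%:R * (iu'%:R / m%:R).
  apply: mean_ge; have := lower_rank_ge a'; rewrite -/iu' /a'.
  by move: g'_le; rewrite -/G GsE; lra.
rewrite mulrBl -mulrA mulfVK ?gt_eqF // in mean.
have iult := lower_rank_lt a0; rewrite -/iu /a in iult.
have : #|lower_set x N iu' :&: S|%:R + 1 <= iu%:R :> R by rewrite natr1 ler_nat.
by move=> h'; rewrite ler1n lt0b; lra.
Qed.

Lemma prob_bad_v : avg N s (fun S => (bad_v N S)%:R)
  <= expR (- (2 * ((1 - kappa) * g) ^+ 2 / s%:R)).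
Proof.
have iN : (iv'.-1 <= #|N|)%N by rewrite cN (leq_trans (leq_pred _)).
have [AN cA _] := lower_setP x iN.
apply: le_trans (hypergeometric_upper_tail AN sN kg0); apply: ler_avg => S SD.
case h : (bad_v N S) => //=; rewrite cA cN.
case/andP: h => bs h.
have mean : s%:R * (iv'.-1%:R / m%:R) <= (th + kappa * (g / s%:R)) * s%:R.
  apply: mean_le; have := upper_rank_lt m b'0; rewrite -/iv' /b'.
  have /andP[iv'0 _] := next_rank_v_bounds.
  have -> : iv'%:R = iv'.-1%:R + 1 :> R by rewrite natr1 prednK.
  by move: g'_le; rewrite -/G GsE; lra.
rewrite mulrDl -mulrA mulfVK ?gt_eqF // in mean.
have ivge := upper_rank_ge b0 bs; rewrite -/iv /b in ivge.
have : iv%:R <= #|lower_set x N iv'.-1 :&: S|%:R :> R by rewrite ler_nat.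
by move=> h'; rewrite ler1n lt0b; lra.
Qed.

Lemma prob_some_bad : avg N s (fun S => (some_bad N S)%:R)
  <= 2 * expR (- (2 * g ^+ 2 / s%:R))
     + 2 * expR (- (2 * ((1 - kappa) * g) ^+ 2 / s%:R)).
Proof.
have := prob_low_u; have := prob_high_v; have := prob_bad_u; have := prob_bad_v.
move=> p1 p2 p3 p4.
apply: (@le_trans _ _ (avg N s (fun S => (low_u N S)%:R + ((high_v N S)%:R
                        + ((bad_u N S)%:R + (bad_v N S)%:R))))).
  apply: ler_avg => S _; rewrite /some_bad -!natrD ler_nat.
  by case: low_u; case: high_v; case: bad_u; case: bad_v.
by rewrite !avgD; lra.
Qed.

End Probabilities.

End Step.

(** * The whole computation *)

Lemma theta_bounds (R : realType) (n k : nat) : (1 <= k <= n)%N -> 0 < theta R n k <= 1.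
Proof.
case/andP=> k0 kn; have n0 : 0 < n%:R :> R by rewrite ltr0n (leq_trans k0).
rewrite /theta; apply/andP; split; first by rewrite divr_gt0 // ltr0n.
by rewrite ler_pdivrMr // mul1r ler_nat.
Qed.

Section Loop.
Context (R : realType) (d : Order.disp_t) (T : orderType d) (n : nat).
Variables (x : 'I_n -> T) (gammaP : R) (sel : {set 'I_n} -> nat -> dtree 'I_n).
Hypotheses (gammaP0 : 0 <= gammaP) (Hsel : selection_subroutine T gammaP sel).
Variables (alpha beta : R) (q k : nat).
Hypothesis k_bounds : (1 <= k <= n)%N.
Implicit Types (S N D : {set 'I_n}) (u v : 'I_n) (l c fuel : nat).

Let sz l := size_at alpha q n l.
Let gp l := gap alpha beta q n l.
Let lb := lbar alpha q n.
Let th : R := theta R n k.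

Hypothesis size_gt0 : forall l, (0 < l)%N -> (0 < sz l)%N.
Hypothesis size_leS : forall l, (0 < l)%N -> (sz l <= sz l.+1)%N.
Hypothesis size_eqn : forall l, (0 < l <= lb)%N -> (sz l.+1 == n) = (l == lb).
Hypothesis gap_ge_half : forall l, (0 < l <= lb)%N -> 2^-1 <= gp l.

(** The minimum of theta and 1 - theta, with the same branching as [partition_cost]. *)
Definition second_comparison_rate : R := if th < 2^-1 then th else 1 - th.
Let rho := second_comparison_rate.

Definition part_bad l S N : bool :=
  if th < 2^-1 then high_v x th (gp l) (sz l) (sz l.+1) N S
  else low_u x th (gp l) (sz l) (sz l.+1) N S.

Definition step_bad l S N : bool :=
  some_bad x th (gp l) (gp l.+1) (sz l) (sz l.+1) N S.

Definition step_good l : R :=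
  (1 + rho) * ((sz l.+1)%:R - (sz l)%:R)
  + (3 + 8 * gammaP) * scaled_gap (gp l) (sz l) (sz l.+1).

Definition step_excess l S N : R :=
  (part_bad l S N)%:R * ((sz l.+1)%:R - (sz l)%:R)
  + (step_bad l S N)%:R * (2 * gammaP * (sz l.+1)%:R).

Let th01 : 0 < th <= 1. Proof. exact: theta_bounds. Qed.

Let gap_ge0 l : 0 <= gp l.
Proof. by rewrite /gp /gap; case: ifP => // _; exact: sqrtr_ge0. Qed.

Let size_le l : (sz l <= n)%N. Proof. exact: geq_minr. Qed.

(** Invariant of the loop. *)
Let ranked l S u v :=
  [/\ #|S| = sz l, ith_smallest x S (rank_u alpha beta q n k l) u
    & ith_smallest x S (rank_v alpha beta q n k l) v].

(** Holds for every draw [D]: randomness enters only through the indicators in [step_excess], which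
    charge a second comparison for all of [D] and two selections from all of S'. *)
Lemma step_costP l S D u v : (0 < l <= lb)%N -> ranked l S u v ->
  D \in draws (~: S) (sz l.+1 - sz l) ->
  let S' := S :|: D in
  let pu := next_pivot x sel S' u v (rank_u alpha beta q n k l.+1) in
  let pv := next_pivot x sel S' u v (rank_v alpha beta q n k l.+1) in
  ranked l.+1 S' pu.1 pv.1 /\
  (partition_cost R k x D u v + pu.2 + pv.2)%:R
    <= step_good l + step_excess l S S'.
Proof.
move=> l1 [cS hu hv] /drawsP[DS cD] S' pu pv; have /andP[l0 _] := l1.
have dSD : [disjoint S & D]%B by rewrite disjoint_sym finset.disjoints_subset.
have SS' : S \subset S' := finset.subsetUl _ _.
have cS' : #|S'| = sz l.+1.
  have /eqP -> : #|S'| == (#|S| + #|D|)%N by rewrite (leq_card_setU _ _).2.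
  by rewrite cS cD subnKC // size_leS.
have DE : S' :\: S = D.
  rewrite /S' finset.setDUl finset.setDv finset.set0U; apply/finset.setDidPl.
  by rewrite disjoint_sym.
have s0 := size_gt0 l0; have sm := size_leS l0; have gl := gap_ge_half l1.
have s1 := leq_trans s0 sm.
have iuv := rank_mono th01 gl s0.
have uv : (x u <= x v)%O.
  by apply: ith_smallest_mono hu hv; rewrite iuv andbT; exact: lower_rank_gt0.
have uS' : u \in S' by case/and3P: hu => uS _ _; apply: (fintype.subsetP SS').
have vS' : v \in S' by case/and3P: hv => vS _ _; apply: (fintype.subsetP SS').
have bu : (0 < rank_u alpha beta q n k l.+1 <= #|S'|)%N.
  by rewrite cS'; exact: next_rank_u_bounds th01 s0 sm (gap_ge0 l.+1).
have bv : (0 < rank_v alpha beta q n k l.+1 <= #|S'|)%N.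
  by rewrite cS'; exact: next_rank_v_bounds th01 s0 sm (gap_ge0 l.+1).
have buv := next_rank_mono th01 s0 sm (gap_ge0 l.+1).
split.
  split=> //.
    exact: (next_pivotP gammaP0 Hsel uS' vS' uv bu).1.
  exact: (next_pivotP gammaP0 Hsel uS' vS' uv bv).1.
have ic : pu.2%:R + pv.2%:R <= 8 * gammaP * scaled_gap (gp l) (sz l) (sz l.+1)
    + (step_bad l S S')%:R * (2 * gammaP * (sz l.+1)%:R).
  case sb : (step_bad l S S').
    have pu_le := next_pivot_cost_max gammaP0 Hsel uS' vS' uv bu.
    have pv_le := next_pivot_cost_max gammaP0 Hsel uS' vS' uv bv.
    have G0 : 0 <= 8 * gammaP * scaled_gap (gp l) (sz l) (sz l.+1).
      by rewrite /scaled_gap mulr_ge0 ?mulr_ge0 ?divr_ge0 ?ler0n.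
    rewrite cS' in pu_le pv_le; rewrite mul1r.
    apply: le_trans (lerD pu_le pv_le) _.
    by move: G0; lra.
  have nsb := negbT sb.
  have pu_le := next_pivot_cost_good gammaP0 Hsel th01 gl s0 sm (gap_ge0 l.+1) SS' cS'
    hu hv nsb (i := rank_u alpha beta q n k l.+1).
  have pv_le := next_pivot_cost_good gammaP0 Hsel th01 gl s0 sm (gap_ge0 l.+1) SS' cS'
    hu hv nsb (i := rank_v alpha beta q n k l.+1).
  rewrite mul0r addr0; apply: le_trans (lerD (pu_le _) (pv_le _)) _.
  - by rewrite leqnn.
  - by rewrite leqnn andbT.
  - by rewrite le_eqVlt; apply/orP; left; apply/eqP; ring.
rewrite !natrD -addrA.
have -> : (partition_cost R k x D u v)%:R = #|D|%:R
    + (if th < 2^-1 then #|below x D v| else #|above x D u|)%:R :> R.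
  rewrite -natrD /partition_cost -/th; case: ifP => _; rewrite big_split /= sum1_card.
    congr (_ + _)%:R; rewrite -sum1_card [RHS](eq_bigl (fun y => (y \in D) && (x y < x v)%O)).
      by rewrite [RHS]big_mkcondr; apply: eq_bigr => y _; case: ifP.
    by move=> y; rewrite inE.
  congr (_ + _)%:R; rewrite -sum1_card [RHS](eq_bigl (fun y => (y \in D) && (x u < x y)%O)).
    by rewrite [RHS]big_mkcondr; apply: eq_bigr => y _; case: ifP.
  by move=> y; rewrite inE.
have cDR : #|D|%:R = (sz l.+1)%:R - (sz l)%:R :> R by rewrite cD natrB.
have D0 : 0 <= #|D|%:R :> R by rewrite ler0n.
have G0 : 0 <= scaled_gap (gp l) (sz l) (sz l.+1).
  by rewrite /scaled_gap divr_ge0 ?mulr_ge0 ?ler0n.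
have part : (if th < 2^-1 then #|below x D v| else #|above x D u|)%:R
   <= rho * #|D|%:R + 3 * scaled_gap (gp l) (sz l) (sz l.+1)
      + (part_bad l S S')%:R * #|D|%:R.
  have rho0 : 0 <= rho.
    rewrite /rho /second_comparison_rate; case: ifP => _; case/andP: th01; [by move/ltW|].
    by rewrite subr_ge0.
  case pb : (part_bad l S S').
    rewrite mul1r; apply: (@le_trans _ _ #|D|%:R).
      rewrite ler_nat; case: ifP => _; rewrite subset_leq_card //;
      by apply/fintype.subsetP => y; rewrite inE => /andP[].
    by rewrite lerDr addr_ge0 ?mulr_ge0.
  rewrite mul0r addr0; move/negbT: pb; rewrite /part_bad /rho /second_comparison_rate.
  case: ifP => _ pb.
    by have := partition_below_v th01 gl s0 sm SS' cS' cS hv pb; rewrite DE.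
  by have := partition_above_u th01 gl s0 sm SS' cS' cS hu pb; rewrite DE.
rewrite /step_good /step_excess -cDR.
by rewrite -/rho; move: part ic; lra.
Qed.

Section Functional.
(* [f] will be either the identity or minus the indicator of a cost bound:
   [h l] dominates the effect on [f] of a failure in step [l], and
   [eta l] is its mean over a uniformly random subsample of a given sample. *)
Variables (f : R -> R) (h : nat -> {set 'I_n} -> {set 'I_n} -> R) (eta : nat -> R).
Hypothesis f_mono : {homo f : a b / a <= b}.
Hypothesis f_excess : forall l S N a, (0 < l <= lb)%N -> S \subset N ->
  #|S| = sz l -> #|N| = sz l.+1 -> f (a + step_excess l S N) <= f a + h l S N.
Hypothesis h_mean : forall l N, (0 < l <= lb)%N -> #|N| = sz l.+1 ->
  avg N (sz l) (fun S => h l S N) <= eta l.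

(** Expected total of [h] over the remaining steps. It depends on the samples but not on the pivots,
    so the order of the draws can be exchanged in it. *)
Fixpoint future (fuel l : nat) S : R :=
  if fuel is fuel'.+1 then
    avg (~: S) (sz l.+1 - sz l) (fun D => h l S (S :|: D) + future fuel' l.+1 (S :|: D))
  else 0.

(** The good part of each cost stays inside [f], while the excess is moved out by [f_excess]. The
    relation between [l] and [fuel] makes the final step [l = lb] consume the last unit. *)
Lemma expect_loop fuel l S u v c : (0 < l)%N -> (l + fuel = lb.+1)%N ->
  ranked l S u v ->
  expect (select_loop alpha beta q x k sel fuel l S u v c) (fun o => f o.2%:R)
    <= f (c%:R + \sum_(l <= j < l + fuel) step_good j) + future fuel l S.
Proof.
elim: fuel l S u v c => [|fuel IH] l S u v c l0 lfuel rk /=.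
  by rewrite addn0 big_geq // !addr0.
have l1 : (0 < l <= lb)%N by lia.
have [cS _ _] := rk.
rewrite -/(avg _ _ _) -/sz.
set tot := (c%:R + _).
have mS : (sz l.+1 - sz l <= #|~: S|)%N by rewrite cardsCs finset.setCK card_ord cS leq_sub2r.
rewrite -[f tot](@avg_cst R _ (~: S) (sz l.+1 - sz l)) // -avgD.
apply: ler_avg => D DS; have [rk' cost] := step_costP l1 rk DS.
move: rk' cost.
case: (next_pivot x sel (S :|: D) u v (rank_u alpha beta q n k l.+1)) => u' cu.
case: (next_pivot x sel (S :|: D) u v (rank_v alpha beta q n k l.+1)) => v' cv /=.
set c' := (c + _ + _ + _)%N => rk' cost.
have [cS' _ _] := rk'.
have fstep a : f (a + step_excess l S (S :|: D)) <= f a + h l S (S :|: D).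
  by apply: f_excess => //; exact: finset.subsetUl.
have c'_le : c'%:R <= c%:R + step_good l + step_excess l S (S :|: D).
  by rewrite /c' -!addnA natrD -addrA lerD2l addnA.
have totE : tot = c%:R + step_good l + \sum_(l.+1 <= j < l.+1 + fuel) step_good j.
  by rewrite /tot addnS big_ltn ?addrA // ltnS leq_addr.
rewrite (size_eqn l1); case: eqP => [lE|_] /=.
  have fuel0 : fuel = 0%N by lia.
  rewrite totE fuel0 addn0 big_geq // !addr0 /=.
  by apply: le_trans (fstep _); apply: f_mono.
have := IH l.+1 (S :|: D) u' v' c' isT _ rk'; rewrite addSn -addnS => /(_ lfuel) ih.
apply: le_trans ih _; rewrite addrA lerD2r; apply: le_trans (fstep _).
apply: f_mono; rewrite totE addnS -addSn.
by rewrite [leRHS]addrAC lerD2r.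
Qed.

(** After [avg_exchange] the current sample is a uniform subsample of the next one, N. So [h_mean]
    bounds the current term, and the later ones depend on N alone. *)
Lemma mean_future fuel l : (0 < l)%N -> (l + fuel = lb.+1)%N ->
  avg [set: 'I_n] (sz l) (future fuel l) <= \sum_(l <= j < l + fuel) eta j.
Proof.
elim: fuel l => [|fuel IH] l l0 lfuel /=.
  by rewrite addn0 big_geq // avg_cst // cardsT card_ord.
have sE : (sz l <= sz l.+1 <= #|[set: 'I_n]%SET|)%N.
  by rewrite size_leS //= cardsT card_ord.
have := avg_exchange (fun S N => h l S N + future fuel l.+1 N) sE.
rewrite (eq_avg (g := future fuel.+1 l)) => [->|S _]; last by rewrite finset.setTD.
rewrite addnS big_ltn ?ltnS ?leq_addr //.
have l1 : (0 < l <= lb)%N by lia.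
apply: (@le_trans _ _ (avg [set: 'I_n] (sz l.+1) (fun N => eta l + future fuel l.+1 N))).
  apply: ler_avg => N /drawsP[_ cN]; rewrite avgD lerD ?h_mean //.
  by rewrite avg_cst // cN size_leS.
rewrite avgD avg_cst ?cardsT ?card_ord // lerD2l.
by apply: le_trans (IH _ _ _) _; rewrite ?addSn // -addnS.
Qed.

Lemma expect_select : (1 < n)%N -> (0 < lb)%N ->
  expect (select alpha beta q x k sel) (fun o => f o.2%:R)
    <= f (2 * gammaP * (sz 1)%:R + \sum_(1 <= j < lb.+1) step_good j)
       + \sum_(1 <= j < lb.+1) eta j.
Proof.
move=> n1 lb0; rewrite /select.
case: pickP => [i /eqP n1E|_]; first by rewrite n1E in n1.
have sz1 : sz 1 = size1 alpha n.
  rewrite /sz /size_at expn0 mul1n; apply/minn_idPl.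
  by apply: leq_trans (geq_minr _ _) (leq_pred _).
rewrite /= -/(avg _ _ _) -sz1.
have szn : (sz 1 <= #|[set: 'I_n]%SET|)%N by rewrite cardsT card_ord.
have := @mean_future lb 1 isT erefl; rewrite add1n => mf.
set A := f _; apply: (@le_trans _ _ (avg [set: 'I_n] (sz 1) (fun S => A + future lb 1 S))).
  apply: ler_avg => S /drawsP[_ cS].
  have l1 : (0 < 1 <= lb)%N by [].
  have iu0 : (0 < rank_u alpha beta q n k 1)%N by exact: lower_rank_gt0.
  have iuv : (rank_u alpha beta q n k 1 <= rank_v alpha beta q n k 1)%N.
    by have := rank_mono th01 (gap_ge_half l1) (size_gt0 (isT : (0 < 1)%N)).
  have b0 : 0 < th * (sz 1)%:R + gp 1.
    case/andP: th01 => th0 _.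
    by rewrite ltr_wpDr // mulr_gt0 // ltr0n size_gt0.
  have ivs : (rank_v alpha beta q n k 1 <= sz 1)%N by exact: upper_rank_le.
  have [|hu cu_le] := Hsel x (S := S) (i := rank_u alpha beta q n k 1).
    by rewrite iu0 cS (leq_trans iuv).
  have [|hv cv_le] := Hsel x (S := S) (i := rank_v alpha beta q n k 1).
    by rewrite (leq_trans iu0 iuv) cS.
  move: hu cu_le hv cv_le; case: dtree_run => u cu /=; case: dtree_run => v cv /=.
  rewrite cS => hu cu_le hv cv_le.
  have rk : ranked 1 S u v by split.
  apply: le_trans (expect_loop (cu + cv) (isT : (0 < 1)%N) (add1n lb) rk) _.
  rewrite add1n.
  rewrite lerD2r; apply: f_mono; rewrite lerD2r natrD.
  by apply: le_trans (lerD cu_le cv_le) _; rewrite -mulrA mulr2n mulrDl !mul1r.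
by rewrite avgD avg_cst // lerD2l.
Qed.

End Functional.

End Loop.

(** * Sample sizes and gaps *)

Section LogBounds.
Variable R : realType.

Lemma expR_le_invr (y : R) : y < 1 -> expR y <= (1 - y)^-1.
Proof.
move=> y1; have := expR_ge1Dx (- y); rewrite expRN => h.
by rewrite -[leLHS]invrK lef_pV2 // posrE ?invr_gt0 ?expR_gt0 ?subr_gt0.
Qed.

(** Reduces a lower bound on the logarithm to rational arithmetic, through e^a <= 1 / (1 - a) raised
    to the power [j]. *)
Lemma ln_lower (a b : R) (j n : nat) (M : nat) : (0 < M)%N -> (M <= n)%N -> a < 1 ->
  b = a * j%:R -> (1 - a)^-1 ^+ j <= M%:R -> b <= ln n%:R.
Proof.
move=> M0 Mn a1 -> h; rewrite -ler_expR lnK ?posrE ?ltr0n ?(leq_trans M0) //.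
rewrite expRM_natr; apply: le_trans (_ : M%:R <= _); last by rewrite ler_nat.
apply: le_trans h; apply: lerXn2r; rewrite ?nnegrE ?expR_ge0 ?expR_le_invr //.
by rewrite invr_ge0 subr_ge0 ltW.
Qed.

(** The constants 25/16 here and 9/4 in [ln_ge10] are squares of 5/4 and 3/2, as needed to bound the
    square root of the logarithm. *)
Lemma ln_ge6 (n : nat) : (6 <= n)%N -> 25 / 16 <= ln n%:R :> R.
Proof.
move=> n6; apply: (ln_lower _ n6 (a := 1 / 16) (j := 25)) => //; first lra.
  by field.
have -> : (1 - 1 / 16)^-1 = 16 / 15 :> R by field.
lra.
Qed.

Lemma ln_ge10 (n : nat) : (10 <= n)%N -> 9 / 4 <= ln n%:R :> R.
Proof.
move=> n10; apply: (ln_lower _ n10 (a := 1 / 32) (j := 72)) => //; first lra.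
  by field.
have -> : (1 - 1 / 32)^-1 = 32 / 31 :> R by field.
(* Rounding after the eighth power keeps the rationals small. *)
rewrite (exprM _ 8 9); have h8 : (32 / 31 : R) ^+ 8 <= 129 / 100 by lra.
apply: (@le_trans _ _ ((129 / 100) ^+ 9)); last lra.
by apply: lerXn2r h8; rewrite nnegrE; lra.
Qed.

End LogBounds.

Section Sizes.
Variables (R : realType) (alpha r kappa beta : R) (q n : nat).
Hypotheses (halpha : 0 < alpha <= 2^-1) (hr : 1 < r) (hq : r ^+ 2 = q%:R).
Hypotheses (hkappa : kappa = r^-1).
Hypothesis hbeta : 4^-1 * ((1 - kappa) ^+ 2)^-1 <= beta.
Hypothesis n6 : (6 <= n)%N.

Let s1 := size1 alpha n.
Let sz l := size_at alpha q n l.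
Let gp l : R := gap alpha beta q n l.
Let lb := lbar alpha q n.
Let nR0 : 0 < n%:R :> R. Proof. by rewrite ltr0n (leq_trans _ n6). Qed.
Let nR1 : 1 <= n%:R :> R. Proof. by rewrite ler1n (leq_trans _ n6). Qed.
Let nR6 : 6 <= n%:R :> R. Proof. by rewrite (ler_nat R 6). Qed.
Let r0 : 0 < r. Proof. exact: lt_trans hr. Qed.
Let lnn := ln_ge6 R n6.
Let lnn0 : 0 < ln n%:R :> R. Proof. by apply: lt_le_trans lnn; rewrite divr_gt0. Qed.

Lemma kappa_bounds : 0 < kappa < 1.
Proof. by rewrite hkappa invr_gt0 r0 invf_lt1. Qed.

Lemma q_gt1 : (1 < q)%N.
Proof. by rewrite -(ltr_nat R) -hq expr2; have := hr; nra. Qed.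

Lemma beta_ge : 4^-1 <= beta.
Proof.
have /andP[k0 k1] := kappa_bounds; have y0 : 0 < (1 - kappa) ^+ 2.
  by rewrite exprn_gt0 // subr_gt0.
apply: le_trans hbeta; rewrite ler_peMr // invf_ge1 //.
by have := k0; have := k1; nra.
Qed.

Let beta0 : 0 < beta. Proof. by apply: lt_le_trans beta_ge; rewrite invr_gt0. Qed.

Let nalpha_le : n%:R `^ alpha <= Num.sqrt n%:R :> R.
Proof. by case/andP: halpha => _ a2; rewrite -powR12_sqrt ?ler0n // ler_powR. Qed.

Let sqrtn2 : 2 <= Num.sqrt n%:R :> R.
Proof.
rewrite -(@ler_pXn2r _ 2) ?nnegrE ?sqrtr_ge0 // sqr_sqrtr ?ler0n //.
by move: nR6; lra.
Qed.

Let sqrtnK : Num.sqrt n%:R ^+ 2 = n%:R :> R. Proof. by rewrite sqr_sqrtr ?ler0n. Qed.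

Let ceil_nat : (`|Num.ceil (n%:R `^ alpha : R)|%N)%:R = (Num.ceil (n%:R `^ alpha : R))%:~R :> R.
Proof.
by rewrite -[LHS]/((Posz _)%:~R) gez0_abs // ltW // ceil_gt0 powR_gt0.
Qed.

Lemma size1_gt0 : (0 < s1)%N.
Proof.
rewrite /s1 /size1 leq_min; apply/andP; split; last by rewrite -ltnS prednK (leq_trans _ n6).
by rewrite -(ltr_nat R) ceil_nat ltr0z ceil_gt0 powR_gt0.
Qed.

Lemma size1_lt : (s1 < n)%N.
Proof.
apply: leq_ltn_trans (geq_minr _ _) _.
by rewrite ltn_predL (leq_trans _ n6).
 Qed.

Lemma size1_ge : n%:R `^ alpha <= s1%:R :> R.
Proof.
rewrite /s1 /size1 /minn; case: ifP => _.
  by rewrite ceil_nat ceil_ge.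
apply: le_trans nalpha_le _.
have -> : n.-1%:R = n%:R - 1 :> R by rewrite -subn1 natrB // (leq_trans _ n6).
by move: sqrtn2 sqrtnK nR6; nra.
Qed.

(** For n >= 10, s1 < sqrt n + 1 <= (3/2) sqrt n and ln n >= 9/4. For smaller n, s1 <= 3 and 9 <= 6
    (25/16). *)
Lemma size1_le_fsel : s1%:R <= fsel (n%:R : R).
Proof.
have s1le : s1%:R <= (Num.ceil (Num.sqrt n%:R : R))%:~R :> R.
  apply: (@le_trans _ _ (Num.ceil (n%:R `^ alpha : R))%:~R).
    by rewrite -ceil_nat ler_nat geq_minl.
  by rewrite ler_int le_ceil.
rewrite /fsel -(@ler_pXn2r _ 2) ?nnegrE ?sqrtr_ge0 ?ler0n //.
rewrite sqr_sqrtr ?mulr_ge0 ?ler0n ?(ltW lnn0) //.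
have [n10|n9] := leqP 10 n.
  have := ln_ge10 R n10 => ln10.
  have : s1%:R < Num.sqrt n%:R + 1 :> R.
    by apply: le_lt_trans s1le _; have := ceilB1_lt (Num.sqrt n%:R : R); rewrite intrB; lra.
  have : 0 <= s1%:R :> R by rewrite ler0n.
  by move: sqrtn2 sqrtnK; nra.
have : s1%:R <= 3 :> R.
  apply: le_trans s1le _; rewrite -[3]/(3%:~R) ler_int ceil_le_int.
  rewrite -(@ler_pXn2r _ 2) ?nnegrE ?sqrtr_ge0 // sqrtnK.
  have : n%:R <= 9 :> R by rewrite (ler_nat R _ 9).
  by rewrite -[3%:~R]/(3 : R); lra.
have : 0 <= s1%:R :> R by rewrite ler0n.
by move: lnn nR6; nra.
Qed.

Let lb_has : has (fun l => (n <= q ^ l * s1)%N) (iota 0 n.+1).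
Proof.
apply/hasP; exists n; first by rewrite mem_iota /= add0n ltnSn.
by apply: leq_trans (ltnW (ltn_expl n q_gt1)) _; rewrite leq_pmulr // size1_gt0.
Qed.

Lemma lbarP : (n <= q ^ lb * s1)%N.
Proof.
have := nth_find 0 lb_has; rewrite nth_iota ?add0n //.
by rewrite -[ltnRHS](size_iota 0) -has_find.
Qed.

Lemma lbar_min l : (l < lb)%N -> (q ^ l * s1 < n)%N.
Proof.
move=> l_lb; have := before_find 0 l_lb; rewrite nth_iota; first by rewrite add0n ltnNge => ->.
by apply: leq_trans l_lb _; rewrite -[leqRHS](size_iota 0) find_size.
Qed.

Lemma lbar_gt0 : (0 < lb)%N.
Proof.
by rewrite lt0n; apply/eqP => lb0; have := lbarP; rewrite lb0 mul1n leqNgt size1_lt.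
Qed.

Lemma size_at_small l : (0 < l <= lb)%N -> sz l = (q ^ l.-1 * s1)%N.
Proof.
case: l => // l /andP[_ ll]; rewrite /sz /size_at /=.
by apply/minn_idPl/ltnW/lbar_min.
Qed.

Lemma size_at_lt l : (0 < l <= lb)%N -> (sz l < n)%N.
Proof.
move=> l1; rewrite size_at_small //; apply: lbar_min; case/andP: l1 => l0 ll.
by rewrite prednK.
Qed.

Lemma size_at_last : sz lb.+1 = n.
Proof. exact/minn_idPr/lbarP. Qed.

Lemma size_atS l : (0 < l < lb)%N -> sz l.+1 = (q * sz l)%N.
Proof.
move=> /andP[l0 ll]; rewrite !size_at_small ?l0 ?(ltnW ll) //=.
by rewrite -{1}(prednK l0) expnS mulnA.
Qed.

Lemma size_at_lbar_ge : (n <= q * sz lb)%N.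
Proof.
rewrite size_at_small ?lbar_gt0 ?leqnn // mulnA -expnS prednK ?lbar_gt0 //.
exact: lbarP.
Qed.

Lemma size_at_gt0 l : (0 < l)%N -> (0 < sz l)%N.
Proof.
move=> l0; rewrite /sz /size_at leq_min muln_gt0 size1_gt0 expn_gt0.
by rewrite (ltnW q_gt1) (leq_trans _ n6).
Qed.

Lemma size_at_leS l : (0 < l)%N -> (sz l <= sz l.+1)%N.
Proof.
move=> l0; rewrite /sz /size_at leq_min geq_minr andbT.
apply: leq_trans (geq_minl _ _) _; rewrite leq_mul2r.
by rewrite leq_exp2l ?q_gt1 // leq_pred orbT.
Qed.

Lemma size_at_eqn l : (0 < l <= lb)%N -> (sz l.+1 == n) = (l == lb).
Proof.
move=> /andP[l0 ll]; have [->|l_lb] := eqVneq l lb; first by rewrite size_at_last eqxx.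
have ll' : (l < lb)%N by rewrite ltn_neqAle l_lb.
by apply/eqP=> e; have := @size_at_lt l.+1 ll'; rewrite e ltnn.
Qed.

Lemma gapE l : (l <= lb)%N -> gp l = Num.sqrt (beta * (sz l)%:R * ln n%:R).
Proof. by rewrite /gp /gap => ->. Qed.

Lemma gap_sqr l : (l <= lb)%N -> gp l ^+ 2 = beta * (sz l)%:R * ln n%:R.
Proof.
by move=> ll; rewrite gapE // sqr_sqrtr // mulr_ge0 ?(ltW lnn0) // mulr_ge0 ?ler0n // ltW.
Qed.

Lemma gap_ge0 l : 0 <= gp l.
Proof. by rewrite /gp /gap; case: ifP => // _; exact: sqrtr_ge0. Qed.

Lemma gap_ge_half l : (0 < l <= lb)%N -> 2^-1 <= gp l.
Proof.
move=> /andP[l0 ll]; rewrite -(@ler_pXn2r _ 2) ?nnegrE ?invr_ge0 ?gap_ge0 //.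
rewrite gap_sqr //.
have s1R : 1 <= (sz l)%:R :> R by rewrite ler1n size_at_gt0.
have bs : 4^-1 <= beta * (sz l)%:R by have := beta_ge; nra.
by have := lnn; nra.
Qed.

(** Before the last step, g_{l+1} = r g_l and the scaled gap is r^2 g_l, so equality holds with
    kappa = 1/r. At the last step the next gap is 0. *)
Lemma gap_next l : (0 < l <= lb)%N ->
  gp l.+1 <= kappa * scaled_gap (gp l) (sz l) (sz l.+1).
Proof.
move=> /andP[l0]; rewrite leq_eqVlt => /orP[/eqP le|ll].
  rewrite le {1}/gp /gap ltnn mulr_ge0 //; first by case/andP: kappa_bounds => /ltW.
  by rewrite /scaled_gap divr_ge0 ?mulr_ge0 ?ler0n ?gap_ge0.
have s0 : (sz l)%:R != 0 :> R by rewrite pnatr_eq0 -lt0n size_at_gt0.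
have -> : scaled_gap (gp l) (sz l) (sz l.+1) = r ^+ 2 * gp l.
  by rewrite /scaled_gap size_atS ?l0 // natrM -hq; field.
rewrite hkappa.
rewrite gapE // (gapE (ltnW ll)) size_atS ?l0 // natrM -hq.
have -> : beta * (r ^+ 2 * (sz l)%:R) * ln n%:R = r ^+ 2 * (beta * (sz l)%:R * ln n%:R) by ring.
rewrite sqrtrM ?exprn_ge0 ?(ltW r0) // sqrtr_sqr gtr0_norm //.
by rewrite le_eqVlt; apply/orP; left; apply/eqP; field; rewrite gt_eqF.
Qed.

(** A growing geometric sum is dominated by its last term. The step to the capped size n violates
    the recurrence and is treated separately in each application. *)
Let sum_geometric (F : nat -> R) (c : R) m : 1 < c -> (0 < m)%N -> (m <= lb)%N ->
  0 <= F 1%N -> (forall l, (0 < l < lb)%N -> F l.+1 = c * F l) ->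
  \sum_(1 <= l < m) F l.+1 <= c / (c - 1) * F m.
Proof.
move=> c1 + + F1 FS; case: m => // m _; elim: m => [_|m IH ml].
  by rewrite big_geq // mulr_ge0 // divr_ge0 // ?subr_ge0 (le_trans _ (ltW c1)).
have Fm := FS m.+1; rewrite ml in Fm.
rewrite big_nat_recr //= Fm //; apply: le_trans (lerD (IH (ltnW ml)) (lexx _)) _.
rewrite le_eqVlt; apply/orP; left; apply/eqP; field.
by rewrite subr_eq0 gt_eqF.
Qed.

Lemma sum_sizes : \sum_(1 <= l < lb.+1) (sz l.+1)%:R
  <= (2 * r ^+ 2 - 1) / (r ^+ 2 - 1) * n%:R.
Proof.
rewrite big_nat_recr ?lbar_gt0 //= size_at_last.
have r21 : 1 < r ^+ 2 by rewrite expr2; have := hr; nra.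
have szS l : (0 < l < lb)%N -> (sz l.+1)%:R = r ^+ 2 * (sz l)%:R :> R.
  by move=> ll; rewrite size_atS // natrM hq.
have sum := @sum_geometric (fun l => (sz l)%:R) _ lb r21 lbar_gt0 (leqnn _) (ler0n _ _) szS.
have c0 : 0 < r ^+ 2 - 1 by rewrite subr_gt0.
apply: le_trans (lerD sum (lexx _)) _.
apply: (@le_trans _ _ (r ^+ 2 / (r ^+ 2 - 1) * n%:R + n%:R)).
  rewrite lerD2r ler_wpM2l ?divr_ge0 ?exprn_ge0 ?(ltW c0) ?(ltW r0) // ler_nat ltnW //.
  by rewrite size_at_lt // lbar_gt0 leqnn.
by rewrite le_eqVlt; apply/orP; left; apply/eqP; field; rewrite gt_eqF.
Qed.

Lemma sum_size_steps :
  \sum_(1 <= l < lb.+1) ((sz l.+1)%:R - (sz l)%:R) = n%:R - s1%:R :> R.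
Proof.
rewrite telescope_sumr ?ltnS ?lbar_gt0 // size_at_last.
by rewrite size_at_small ?lbar_gt0 // expn0 mul1n.
Qed.

(** Relative to sqrt (beta n ln n), the geometric part contributes r^2 / (r - 1) and the last step
    contributes r. *)
Lemma sum_scaled_gaps : \sum_(1 <= l < lb.+1) scaled_gap (gp l) (sz l) (sz l.+1)
  <= (2 * r ^+ 2 - r) / (r - 1) * Num.sqrt beta * fsel n%:R.
Proof.
have B0 : 0 <= Num.sqrt beta * Num.sqrt (ln n%:R) by rewrite mulr_ge0 ?sqrtr_ge0.
have gpE l : (l <= lb)%N -> gp l = Num.sqrt beta * Num.sqrt (ln n%:R) * Num.sqrt (sz l)%:R.
  move=> ll; rewrite gapE // sqrtrM ?mulr_ge0 ?ler0n ?ltW // sqrtrM ?ltW //.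
  by rewrite mulrAC.
have sqS l : (0 < l < lb)%N -> Num.sqrt (sz l.+1)%:R = r * Num.sqrt (sz l)%:R :> R.
  by move=> ll; rewrite size_atS // natrM -hq sqrtrM ?exprn_ge0 ?ltW // sqrtr_sqr gtr0_norm.
have GE l : (0 < l < lb)%N -> scaled_gap (gp l) (sz l) (sz l.+1)
    = Num.sqrt beta * Num.sqrt (ln n%:R) * r * Num.sqrt (sz l.+1)%:R.
  move=> ll; have /andP[l0 llb] := ll.
  have s0 : (sz l)%:R != 0 :> R by rewrite pnatr_eq0 -lt0n size_at_gt0.
  rewrite sqS // /scaled_gap size_atS // natrM gpE ?(ltnW llb) // -hq.
  by field.
rewrite big_nat_recr ?lbar_gt0 //= size_at_last big_nat_cond.
rewrite (eq_bigr (fun l => Num.sqrt beta * Num.sqrt (ln n%:R) * r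
                             * Num.sqrt (sz l.+1)%:R)); last first.
  by move=> l /andP[ll _]; exact: GE.
rewrite -big_nat_cond -mulr_sumr.
have sum := @sum_geometric (fun l => Num.sqrt (sz l)%:R) r lb hr lbar_gt0 (leqnn _)
  (sqrtr_ge0 _) sqS.
set w := Num.sqrt (sz lb)%:R in sum.
have wlt : w <= Num.sqrt n%:R.
  by rewrite ler_sqrt ?ler0n // ler_nat ltnW // size_at_lt // lbar_gt0 leqnn.
have w0 : 0 < w by rewrite sqrtr_gt0 ltr0n size_at_gt0 // lbar_gt0.
(* The last sample grows by a factor at most r^2, so n / w <= r sqrt n. *)
have last : scaled_gap (gp lb) (sz lb) n
    <= Num.sqrt beta * Num.sqrt (ln n%:R) * (r * Num.sqrt n%:R).
  rewrite /scaled_gap gpE // -/w -!mulrA; do 2?apply: ler_wpM2l; rewrite ?sqrtr_ge0 //.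
  have -> : (sz lb)%:R = w ^+ 2 :> R by rewrite sqr_sqrtr ?ler0n.
  have -> : w * (n%:R / w ^+ 2) = n%:R / w by field; rewrite gt_eqF.
  rewrite ler_pdivrMr // -{1}sqrtnK expr2 mulrAC ler_wpM2r ?sqrtr_ge0 //.
  rewrite -(@ler_pXn2r _ 2) ?nnegrE ?mulr_ge0 ?sqrtr_ge0 ?(ltW w0) ?(ltW r0) //.
  rewrite exprMn sqrtnK sqr_sqrtr ?ler0n // hq -natrM ler_nat.
  exact: size_at_lbar_ge.
have fE : fsel n%:R = Num.sqrt n%:R * Num.sqrt (ln n%:R) :> R by rewrite /fsel sqrtrM ?ler0n.
have r10 : 0 < r - 1 by rewrite subr_gt0.
apply: le_trans (lerD (ler_wpM2l _ sum) last) _; first by rewrite mulr_ge0 // (ltW r0).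
apply: (@le_trans _ _ (Num.sqrt beta * Num.sqrt (ln n%:R) * r * (r / (r - 1) * Num.sqrt n%:R)
   + Num.sqrt beta * Num.sqrt (ln n%:R) * (r * Num.sqrt n%:R))).
  rewrite lerD2r; apply: ler_wpM2l; first by rewrite mulr_ge0 // (ltW r0).
  by rewrite ler_wpM2l // divr_ge0 // ltW.
by rewrite fE le_eqVlt; apply/orP; left; apply/eqP; field; rewrite gt_eqF.
Qed.

(** The gaps are scaled so that g_l^2 / s_l = beta ln n for every such l. *)
Lemma tail_power l : (0 < l <= lb)%N ->
  expR (- (2 * gp l ^+ 2 / (sz l)%:R)) = n%:R `^ (- (2 * beta)).
Proof.
move=> /andP[l0 ll]; have s0 : (sz l)%:R != 0 :> R by rewrite pnatr_eq0 -lt0n size_at_gt0.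
rewrite /powR (gt_eqF nR0) gap_sqr //; by congr expR; field.
Qed.

Lemma tail_power_kappa l : (0 < l <= lb)%N ->
  expR (- (2 * ((1 - kappa) * gp l) ^+ 2 / (sz l)%:R))
  = n%:R `^ (- (2 * (1 - kappa) ^+ 2 * beta)).
Proof.
move=> /andP[l0 ll]; have s0 : (sz l)%:R != 0 :> R by rewrite pnatr_eq0 -lt0n size_at_gt0.
by rewrite /powR (gt_eqF nR0) exprMn gap_sqr //; congr expR; field.
Qed.

Lemma tail_power_le :
  n%:R `^ (- (2 * beta)) <= n%:R `^ (- (2 * (1 - kappa) ^+ 2 * beta)) :> R.
Proof.
rewrite ler_powR // lerN2 ler_wpM2r ?(ltW beta0) //.
rewrite ler_piMr // expr_le1 ?subr_ge0 ?gerBl; case/andP: kappa_bounds => /ltW k0 /ltW //.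
Qed.

Lemma P_fail_le : P_fail kappa beta n <= 4 * n%:R `^ (- (2 * (1 - kappa) ^+ 2 * beta)).
Proof. by rewrite /P_fail; move: tail_power_le; lra. Qed.

(** With m the ceiling, q^m >= n^(1 - alpha) and s1 >= n^alpha, so m qualifies in the minimum
    defining [lbar]. *)
Lemma lbar_le_ceil :
  lb%:R <= (Num.ceil ((1 - alpha) * ln n%:R / ln (r ^+ 2)))%:~R :> R.
Proof.
have q1R : 1 < q%:R :> R by rewrite ltr1n q_gt1.
have lnq : 0 < ln (r ^+ 2) by rewrite hq ln_gt0.
set c := (1 - alpha) * ln n%:R / ln (r ^+ 2).
have c0 : 0 < c.
  rewrite divr_gt0 // mulr_gt0 // subr_gt0; case/andP: halpha => _ a2.
  by apply: le_lt_trans a2 _; lra.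
have cE : (`|Num.ceil c|%N)%:R = (Num.ceil c)%:~R :> R.
  by rewrite -[LHS]/((Posz _)%:~R) gez0_abs // ltW // ceil_gt0.
rewrite -cE ler_nat leqNgt; apply/negP => /lbar_min; apply/negP; rewrite -leqNgt.
rewrite -(ler_nat R) natrM natrX.
set m := `|Num.ceil c|%N in cE *.
have cm : c <= m%:R by rewrite cE ceil_ge.
have s1R := size1_ge; have s10 : 0 < n%:R `^ alpha :> R by rewrite powR_gt0.
apply: (@le_trans _ _ (n%:R `^ (1 - alpha) * n%:R `^ alpha)).
  by rewrite -powRD ?subrK ?powRr1 ?ler0n // (gt_eqF nR0) implybT.
apply: ler_pM => //; rewrite ?powR_ge0 //.
rewrite -powR_mulrn ?ler0n // /powR !gt_eqF ?(lt_trans _ q1R) //.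
by rewrite ler_expR -hq -ler_pdivrMr.
Qed.

End Sizes.

(** * The bounds of the theorem *)

Section Constants.
Variables (R : realType) (alpha r kappa beta gammaP : R) (q : nat).
Hypotheses (halpha : 0 < alpha <= 2^-1) (hr : 1 < r) (hq : r ^+ 2 = q%:R).
Hypotheses (hkappa : kappa = r^-1).
Hypothesis hbeta : 4^-1 * ((1 - kappa) ^+ 2)^-1 <= beta.
Hypothesis hgammaP : 2 < gammaP.

Let kappa2_gt0 : 0 < (1 - kappa) ^+ 2.
Proof. by have /andP[_ k1] := kappa_bounds hr hkappa; rewrite exprn_gt0 // subr_gt0. Qed.

(** The power of n has a nonpositive exponent by the bound on beta. It remains to have c w <= 2 and
    w <= 1, where w = 1 / sqrt (ln n): for q >= 3, c <= 5/2 and w <= 4/5; for q = 2, c = 3 calls for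
    w <= 2/3, that is ln n >= 9/4. *)
Lemma gamma_bar_le n : (6 <= n)%N -> (3 <= q)%N || (10 <= n)%N ->
  gamma_bar gammaP r kappa beta n <= gamma_hat gammaP r beta + 16 * gammaP + 2.
Proof.
move=> n6 qn; have lnn := ln_ge6 R n6; have lnn0 : 0 < ln n%:R :> R by lra.
have q2 := q_gt1 hr hq.
rewrite /gamma_bar -[leRHS]addrA lerD2l.
set E := n%:R `^ _; set w := _ `^ _; set c := (2 * r ^+ 2 - 1) / (r ^+ 2 - 1).
have E0 : 0 <= E by exact: powR_ge0.
have E1 : E <= 1.
  rewrite -(powRr0 n%:R) /E ler_powR //; first by rewrite ler1n (leq_trans _ n6).
  have : 4^-1 <= (1 - kappa) ^+ 2 * beta.
    by have := hbeta; rewrite ler_pdivrMr // mulrC.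
  by lra.
have w0 : 0 <= w by exact: powR_ge0.
have wE : w * Num.sqrt (ln n%:R) = 1.
  by rewrite /w powRN powR12_sqrt ?(ltW lnn0) // mulVf // gt_eqF // sqrtr_gt0.
have q2R : 2 <= q%:R :> R by rewrite (ler_nat R 2).
have cw : c * w <= 2 /\ w <= 1.
  rewrite /c hq; have q10 : 0 < q%:R - 1 :> R by lra.
  suff : (2 * q%:R - 1) * w <= 2 * (q%:R - 1) /\ w <= 1.
    by move=> [h ->]; split=> //; rewrite mulrAC ler_pdivrMr.
  have sq_le a : 0 <= a -> a ^+ 2 <= ln n%:R -> a * w <= 1.
    move=> a0 h; rewrite -wE mulrC ler_wpM2l //.
    by rewrite -(@ler_pXn2r _ 2) ?nnegrE ?sqrtr_ge0 // sqr_sqrtr // ltW.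
  case/orP: qn => [q3|n10].
    have q3R : 3 <= q%:R :> R by rewrite (ler_nat R 3).
    have : 5 / 4 * w <= 1 by apply: sq_le; lra.
    by split; nra.
  have ln10 := ln_ge10 R n10.
  have : 3 / 2 * w <= 1 by apply: sq_le; lra.
  by split; nra.
case: cw => cw w1.
have c0 : 0 <= c by rewrite /c hq divr_ge0; lra.
have X0 : 0 <= 4 * (c * (2 * gammaP) + 2^-1) * w.
  by rewrite !mulr_ge0 // addr_ge0 // mulr_ge0 //; move: hgammaP; lra.
apply: (@le_trans _ _ (4 * (c * (2 * gammaP) + 2^-1) * w)).
  by rewrite mulrAC ler_piMr.
have : c * w * (8 * gammaP) <= 2 * (8 * gammaP).
  by rewrite ler_wpM2r //; move: hgammaP; lra.
by move: w1; lra.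
Qed.

Lemma lbar_P_fail_le n : (6 <= n)%N ->
  (lbar alpha q n)%:R * P_fail kappa beta n
    <= 4 * (Num.ceil ((1 - alpha) * ln n%:R / ln (r ^+ 2)))%:~R
         * n%:R `^ (- (2 * (1 - kappa) ^+ 2 * beta)).
Proof.
move=> n6; have := lbar_le_ceil halpha hr hq n6 => lb.
have pf := P_fail_le hr hkappa hbeta n6.
rewrite mulrAC [leRHS]mulrC; apply: ler_pM => //.
by rewrite /P_fail addr_ge0 // mulr_ge0 ?powR_ge0.
Qed.

(** Put z = n^(dt / 2), where dt is the excess of the exponent over 1. Then n^(-t) = n^(-1) / z^2,
    while the logarithmic factor is at most a constant times z, so a factor 1 / z remains. *)
Lemma lbar_P_fail_littleo : 2^-1 * ((1 - kappa) ^+ 2)^-1 < beta ->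
  (fun n : nat => (lbar alpha q n)%:R * P_fail kappa beta n : R^o)
    =o_\oo (fun n : nat => n%:R^-1 : R^o).
Proof.
rewrite ltr_pdivrMr // mulrC => hb.
set t := 2 * (1 - kappa) ^+ 2 * beta.
pose dt := t - 1; have dt0 : 0 < dt by rewrite /dt /t; lra.
have q1R : 1 < q%:R :> R by rewrite ltr1n (q_gt1 hr hq).
have lnq : 0 < ln (r ^+ 2) by rewrite hq ln_gt0.
pose a := (1 - alpha) / ln (r ^+ 2).
have a0 : 0 < a by rewrite divr_gt0 //; case/andP: halpha; lra.
apply/eqoP => eps eps0.
pose K := 4 * (2 * a / dt + 1) / eps.
have K0 : 0 <= K.
  apply: divr_ge0 (ltW eps0); apply: mulr_ge0 => //; apply: addr_ge0 => //.
  by apply: divr_ge0 (ltW dt0); apply: mulr_ge0 => //; exact: ltW.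
near=> n.
have n6 : (6 <= n)%N by near: n; exact: nbhs_infty_ge.
have nK : K `^ (2 / dt) <= n%:R by near: n; exact: nbhs_infty_ger.
have n0 : 0 < n%:R :> R by rewrite ltr0n (leq_trans _ n6).
have n1 : 1 <= n%:R :> R by rewrite ler1n (leq_trans _ n6).
pose z : R := n%:R `^ (dt / 2).
have zK : K <= z.
  have : (K `^ (2 / dt)) `^ (dt / 2) <= z.
    by apply: ge0_ler_powR => //; rewrite ?nnegrE ?powR_ge0 ?divr_ge0 ?(ltW dt0).
  rewrite -powRrM; have -> : 2 / dt * (dt / 2) = 1 by field; rewrite gt_eqF.
  by rewrite powRr1.
have z1 : 1 <= z by rewrite /z -[leLHS](powRr0 n%:R) ler_powR // divr_ge0 ?(ltW dt0).
have z0 : 0 < z by exact: lt_le_trans z1.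
have lnz : ln n%:R <= 2 / dt * z.
  have := ln_sublinear z0; rewrite /z ln_powR -/z => /ltW h.
  have -> : ln n%:R = 2 / dt * (dt / 2 * ln n%:R) by field; rewrite gt_eqF.
  by rewrite ler_wpM2l // divr_ge0 // ltW.
have pt : n%:R `^ (- t) = n%:R^-1 / z ^+ 2.
  rewrite -powR_mulrn ?powR_ge0 // -powRrM -powRN -{1}(powR_inv1 (ltW n0)) -powRD; last first.
    by rewrite (gt_eqF n0) implybT.
  by congr (_ `^ _); rewrite /dt; field.
rewrite normrM !ger0_norm ?ler0n ?invr_ge0 ?ler0n //; last first.
  by rewrite /P_fail addr_ge0 // mulr_ge0 ?powR_ge0.
apply: le_trans (lbar_P_fail_le n6) _; rewrite -/t pt.
set C : R := (Num.ceil _)%:~R.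
have C_le : C <= (2 * a / dt + 1) * z.
  have : C <= a * ln n%:R + 1.
    rewrite /C; have := ceilB1_lt ((1 - alpha) * ln n%:R / ln (r ^+ 2)).
    have -> : (1 - alpha) * ln n%:R / ln (r ^+ 2) = a * ln n%:R by rewrite /a mulrAC.
    by rewrite intrB; lra.
  have : a * ln n%:R <= a * (2 / dt * z) by rewrite ler_wpM2l // ltW.
  have -> : (2 * a / dt + 1) * z = a * (2 / dt * z) + z by ring.
  by move: z1; lra.
have KE : K * eps = 4 * (2 * a / dt + 1) by rewrite /K mulfVK // gt_eqF.
rewrite mulrA mulrAC ler_wpM2r ?invr_ge0 ?ler0n // ler_pdivrMr ?exprn_gt0 //.
apply: (@le_trans _ _ (K * eps * z)); first by rewrite KE; move: C_le; lra.
have -> : K * eps * z = eps * (K * z) by ring.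
by rewrite expr2 ler_wpM2l ?(ltW eps0) // ler_wpM2r // ltW.
Unshelve. all: by end_near. Qed.

End Constants.

Lemma expectN (R : realType) (I : finType) (A : Type) (t : rand I A) (f : A -> R) :
  expect t (fun o => - f o) = - expect t f.
Proof.
elim: t => [//|E m t IH] /=; rewrite -mulNr -sumrN.
by congr (_ / _); apply: eq_bigr => B _.
Qed.


(** * Cost with high probability and in expectation *)

Section Cost.
Context (R : realType) (alpha r kappa beta gammaP : R) (q n : nat).
Hypotheses (halpha : 0 < alpha <= 2^-1) (hr : 1 < r) (hq : r ^+ 2 = q%:R).
Hypotheses (hkappa : kappa = r^-1).
Hypothesis hbeta : 4^-1 * ((1 - kappa) ^+ 2)^-1 <= beta.
Hypotheses (hgammaP : 2 < gammaP) (n6 : (6 <= n)%N).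
Context (d : Order.disp_t) (T : orderType d) (x : 'I_n -> T) (k : nat).
Context (sel : {set 'I_n} -> nat -> dtree 'I_n).
Hypotheses (k_bounds : (1 <= k <= n)%N) (Hsel : selection_subroutine T gammaP sel).

Implicit Types N S : {set 'I_n}.

Let gammaP0 : 0 <= gammaP. Proof. by move: hgammaP; lra. Qed.
Let kappa01 : 0 <= kappa <= 1.
Proof. by have /andP[/ltW -> /ltW ->] := kappa_bounds hr hkappa. Qed.
Let lb := lbar alpha q n.
Let sz l := size_at alpha q n l.
Let bound : R := n%:R + (minn k (n - k))%:R + gamma_hat gammaP r beta * fsel n%:R.
Let p : R := n%:R `^ (- (2 * (1 - kappa) ^+ 2 * beta)).

Let size_gt0 l : (0 < l)%N -> (0 < sz l)%N.
Proof. by move=> l1; exact: (size_at_gt0 alpha hr hq n6 l1). Qed.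
Let size_leS l : (0 < l)%N -> (sz l <= sz l.+1)%N.
Proof. by move=> l1; exact: (size_at_leS alpha n hr hq l1). Qed.
Let size_eqn l : (0 < l <= lb)%N -> (sz l.+1 == n) = (l == lb).
Proof. by move=> l1; exact: (size_at_eqn hr hq n6 l1). Qed.
Let gap_half l : (0 < l <= lb)%N -> 2^-1 <= gap alpha beta q n l.
Proof. by move=> l1; exact: (gap_ge_half hr hq hkappa hbeta n6 l1). Qed.
Let gap_next' l : (0 < l <= lb)%N ->
  gap alpha beta q n l.+1 <= kappa * scaled_gap (gap alpha beta q n l) (sz l) (sz l.+1).
Proof. by move=> l1; exact: (gap_next beta hr hq hkappa n6 l1). Qed.

Let n0 : 0 < n%:R :> R. Proof. by rewrite ltr0n (leq_trans _ n6). Qed.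

Let lb_gt0 : (0 < lb)%N. Proof. exact: (lbar_gt0 alpha hr hq n6). Qed.

(** The growths of the samples telescope to n - s1, and the rate times n is at most min(k, n - k).
    The initial selections are paid by s1 <= f(n), the remaining terms by [sum_scaled_gaps]. *)
Lemma total_good_le :
  2 * gammaP * (sz 1)%:R + \sum_(1 <= j < lb.+1) step_good n gammaP alpha beta q k j <= bound.
Proof.
rewrite /step_good big_split /= -!mulr_sumr (sum_size_steps alpha hr hq n6).
have sz1 : sz 1 = size1 alpha n.
  by rewrite /sz size_at_small ?lb_gt0 // expn0 mul1n.
rewrite sz1; set s1 := size1 alpha n.
have G := sum_scaled_gaps alpha hr hq hkappa hbeta n6.
have s1f := size1_le_fsel halpha n6; rewrite -/s1 in s1f.
have s10 : 0 <= s1%:R :> R by rewrite ler0n.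
have s1n : s1%:R <= n%:R :> R by rewrite ler_nat ltnW // size1_lt.
have rho : 0 <= second_comparison_rate R n k /\ second_comparison_rate R n k * n%:R <= (minn k (n - k))%:R :> R.
  have /andP[k1 kn] := k_bounds.
  have tE : theta R n k * n%:R = k%:R by rewrite /theta mulfVK // gt_eqF.
  have t1 : theta R n k <= 1 by rewrite /theta ler_pdivrMr // mul1r ler_nat.
  have t0 : 0 <= theta R n k by rewrite /theta divr_ge0.
  have nk : (n - k)%:R = n%:R - k%:R :> R by rewrite natrB.
  rewrite /second_comparison_rate; case: ifP => h; split; rewrite ?subr_ge0 //.
    rewrite tE ler_nat leq_min leqnn /= -(ler_nat R) nk -tE.
    by move: h n0; nra.
  rewrite mulrBl mul1r tE -nk ler_nat leq_min leqnn andbT -(ler_nat R) nk -tE.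
  by move/negbT: h; rewrite -leNgt; move: n0; nra.
case: rho => rho0 rho_le.
have h1 : (1 + second_comparison_rate R n k) * (n%:R - s1%:R) <= n%:R + (minn k (n - k))%:R.
  have : 0 <= second_comparison_rate R n k * s1%:R by rewrite mulr_ge0.
  by move: rho_le; lra.
have h2 : 2 * gammaP * s1%:R <= 2 * gammaP * fsel n%:R by rewrite ler_wpM2l // mulr_ge0.
have h3 := ler_wpM2l (addr_ge0 (ler0n R 3) (mulr_ge0 (ler0n R 8) gammaP0)) G.
rewrite /bound /gamma_hat.
by move: h1 h2 h3; lra.
Qed.

Let step_bad_mean l N : (0 < l <= lb)%N -> #|N| = sz l.+1 ->
  avg N (sz l) (fun S => (step_bad x alpha beta q k l S N)%:R) <= P_fail kappa beta n.
Proof.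
move=> l1 cN; have /andP[l0 _] := l1.
have th01 := theta_bounds R k_bounds.
have := prob_some_bad x th01 (gap_half l1) (size_gt0 l0) (size_leS l0)
  (gap_ge0 alpha beta q n l.+1) kappa01 (gap_next' l1) cN.
rewrite (tail_power hr hq hkappa hbeta n6 l1).
by rewrite (tail_power_kappa hr hq hkappa hbeta n6 l1).
Qed.

Let part_bad_mean l N : (0 < l <= lb)%N -> #|N| = sz l.+1 ->
  avg N (sz l) (fun S => (part_bad x alpha beta q k l S N)%:R) <= p.
Proof.
move=> l1 cN; have /andP[l0 _] := l1.
have th01 := theta_bounds R k_bounds.
apply: le_trans (tail_power_le hr hkappa hbeta n6).
rewrite -(tail_power hr hq hkappa hbeta n6 l1) /part_bad.
case: (theta R n k < 2^-1).
  by have := prob_high_v x th01 (gap_half l1) (size_gt0 l0) (size_leS l0) cN.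
by have := prob_low_u x th01 (gap_half l1) (size_gt0 l0) (size_leS l0) cN.
Qed.

Let n_gt1 : (1 < n)%N. Proof. exact: leq_trans n6. Qed.

Lemma prob_cost_le :
  1 - lb%:R * P_fail kappa beta n
    <= prob (select alpha beta q x k sel) (fun o => o.2%:R <= bound).
Proof.
rewrite /prob -[leRHS]opprK -expectN lerNr opprB.
(* Minus the indicator is nondecreasing in the cost, and a failure raises it by at most 1; so [h] is
   the indicator of [step_bad]. *)
pose f (c : R) : R := - (c <= bound)%R%:R.
have f_mono : {homo f : a b / a <= b}.
  move=> a b ab; rewrite /f lerN2 ler_nat; case: (lerP b bound) => //= bb.
  by rewrite (le_trans ab bb).
have := @expect_select R d T n x gammaP sel gammaP0 Hsel alpha beta q k
  k_bounds size_gt0 size_leS size_eqn gap_half f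
  (fun l S N => (step_bad x alpha beta q k l S N)%:R) (fun=> P_fail kappa beta n) f_mono _
  step_bad_mean n_gt1 lb_gt0.
move=> /(_ _)/le_trans; apply.
  move=> l S N a l1 SN cS cN; rewrite /f /step_excess.
  case sb : (step_bad _ _ _ _ _ _ _ _).
    rewrite -/(f _) lerNl opprD opprK; case: (a <= bound) => /=; rewrite ?subrr ?ler0n //.
    by rewrite sub0r (le_trans _ (ler0n _ _)) // lerN10.
  (* [part_bad] is one of the events in [step_bad], so without the latter there is no excess at
     all. *)
  have -> : part_bad x alpha beta q k l S N = false.
    apply/negbTE; move/negbT: sb; apply: contra; rewrite /part_bad /step_bad /some_bad.
    by case: ifP => _ ->; rewrite ?orbT.
  by rewrite !mul0r !addr0.
rewrite big_const_nat iter_addr addr0 subSS subn0 /f total_good_le /=.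
by rewrite -[P_fail _ _ _ *+ _]mulr_natl addrC.
Qed.

(** Here [f] is the identity. The excess averages to at most p n for the partitions, and to at most
    4 p times 2 gammaP times the sum of the sample sizes for the selections. *)
Lemma expect_cost_le : expect (select alpha beta q x k sel) (fun o => o.2%:R)
  <= n%:R + (minn k (n - k))%:R + gamma_bar gammaP r kappa beta n * fsel n%:R.
Proof.
pose eta l := p * ((sz l.+1)%:R - (sz l)%:R) + P_fail kappa beta n * (2 * gammaP * (sz l.+1)%:R).
have h_mean l N : (0 < l <= lb)%N -> #|N| = sz l.+1 ->
    avg N (sz l) (fun S => step_excess x gammaP alpha beta q k l S N) <= eta l.
  move=> l1 cN; have /andP[l0 _] := l1.
  have -> : (fun S => step_excess x gammaP alpha beta q k l S N)
    = (fun S => ((sz l.+1)%:R - (sz l)%:R) * (part_bad x alpha beta q k l S N)%:R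
       + (2 * gammaP * (sz l.+1)%:R) * (step_bad x alpha beta q k l S N)%:R).
    by apply/funext => S; rewrite /step_excess; congr (_ + _); rewrite mulrC.
  rewrite avgD !avgZ /eta ![_ * (_ * _%:R)]mulrC [p * _]mulrC.
  apply: lerD; apply: ler_wpM2l; rewrite ?part_bad_mean ?step_bad_mean //.
    by rewrite subr_ge0 ler_nat size_leS.
  by rewrite mulr_ge0 ?mulr_ge0.
have := @expect_select R d T n x gammaP sel gammaP0 Hsel alpha beta q k
  k_bounds size_gt0 size_leS size_eqn gap_half id
  (step_excess x gammaP alpha beta q k) eta (fun a b ab => ab) (fun l S N a _ _ _ _ => lexx _)
  h_mean n_gt1 lb_gt0.
move/le_trans; apply.
apply: le_trans (lerD total_good_le (lexx _)) _.
rewrite /bound -[leLHS]addrA lerD2l /gamma_bar [leRHS]mulrDl lerD2l.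
rewrite /eta big_split /= -!mulr_sumr (sum_size_steps alpha hr hq n6).
have p0 : 0 <= p by exact: powR_ge0.
have sums := sum_sizes alpha hr hq n6.
have pf := P_fail_le hr hkappa hbeta n6; rewrite -/p in pf.
have lnn := ln_ge6 R n6; have lnn0 : 0 < ln n%:R :> R by lra.
(* The extra factors in [gamma_bar] are those that turn f(n) into p n. *)
have pE : n%:R `^ (2^-1 - 2 * (1 - kappa) ^+ 2 * beta) * ln n%:R `^ (- 2^-1) * fsel n%:R
    = p * n%:R :> R.
  rewrite /fsel sqrtrM ?ler0n // powRD; last by rewrite (gt_eqF n0) implybT.
  rewrite -/p powRN !powR12_sqrt ?ler0n ?(ltW lnn0) //.
  have sn : Num.sqrt n%:R ^+ 2 = n%:R :> R by rewrite sqr_sqrtr ?ler0n.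
  rewrite -[in RHS]sn; field.
  by rewrite gt_eqF // sqrtr_gt0.
set c := (2 * r ^+ 2 - 1) / (r ^+ 2 - 1) in sums *.
have assoc (K A B F : R) : K * A * B * F = K * (A * B * F) by ring.
rewrite assoc pE.
set Sig := \sum_(1 <= l < _) _ in sums *.
have h1 : p * (n%:R - (size1 alpha n)%:R) <= p * n%:R.
  by rewrite ler_wpM2l // gerBl.
have Sig0 : 0 <= Sig by apply: sumr_ge0.
have h2 : P_fail kappa beta n * (2 * gammaP * Sig) <= 4 * p * (2 * gammaP * (c * n%:R)).
  apply: ler_pM => //; rewrite ?mulr_ge0 // ?ler_wpM2l ?mulr_ge0 //.
  by rewrite /P_fail addr_ge0 // mulr_ge0 ?powR_ge0.
have pn : 0 <= p * n%:R by rewrite mulr_ge0.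
by move: h1 h2 pn; lra.
Qed.

End Cost.

Theorem theorem2 (R : realType) (alpha r kappa beta gammaP : R) (q : nat)
  (halpha : 0 < alpha <= 2^-1)
  (hr : 1 < r) (hq : r ^+ 2 = q%:R)
  (hkappa : kappa = r^-1)
  (hbeta : 4^-1 * ((1 - kappa) ^+ 2)^-1 <= beta)
  (hgammaP : 2 < gammaP) :
  (forall n : nat, (6 <= n)%N ->
    [/\ forall (d : Order.disp_t) (T : orderType d) (x : 'I_n -> T) (k : nat)
           (sel : {set 'I_n} -> nat -> dtree 'I_n),
          (1 <= k <= n)%N ->
          selection_subroutine T gammaP sel ->
          prob (select alpha beta q x k sel)
               (fun o => o.2%:R <= n%:R + (minn k (n - k))%:R
                                   + gamma_hat gammaP r beta * fsel n%:R)
            >= 1 - (lbar alpha q n)%:R * P_fail kappa beta n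
          /\
          expect (select alpha beta q x k sel) (fun o => o.2%:R)
            <= n%:R + (minn k (n - k))%:R
               + gamma_bar gammaP r kappa beta n * fsel n%:R,
        (lbar alpha q n)%:R * P_fail kappa beta n
          <= 4 * (Num.ceil ((1 - alpha) * ln n%:R / ln (r ^+ 2)))%:~R
               * n%:R `^ (- (2 * (1 - kappa) ^+ 2 * beta))
      & (3 <= q)%N || (10 <= n)%N ->
          gamma_bar gammaP r kappa beta n
            <= gamma_hat gammaP r beta + 16 * gammaP + 2])
  /\
  (2^-1 * ((1 - kappa) ^+ 2)^-1 < beta ->
    (fun n : nat => (lbar alpha q n)%:R * P_fail kappa beta n : R^o)
      =o_\oo (fun n : nat => n%:R^-1 : R^o)).
Proof.
split; last exact: (lbar_P_fail_littleo halpha hr hq hkappa hbeta).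
move=> n n6; split; last exact: (gamma_bar_le hr hq hkappa hbeta hgammaP n6).
- move=> d T x k sel k_bounds Hsel; split.
    exact: (prob_cost_le halpha hr hq hkappa hbeta hgammaP n6 x k_bounds Hsel).
  exact: (expect_cost_le halpha hr hq hkappa hbeta hgammaP n6 x k_bounds Hsel).
- exact: (lbar_P_fail_le halpha hr hq hkappa hbeta n6).
Qed.
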